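(* Let $x_0$ be a minimizer of the problem $\min_{x\in\mathbb{R}^n}\|D^*x\|_{1,2}$ subject to $\Phi x=y_0$, and let $v\in\partial\|\cdot\|_{1,2}(D^*x_0)$ with $Dv\in\Delta(x_0)$, and let $\mathcal{K}=\{J\in\mathcal{I}^c\mid\|v_J\|=1\}$, $\mathcal{H}=\{J\in\mathcal{I}^c\mid\|v_J\|<1\}$. Suppose that for every $w\in W(x_0)$ the following implication holds for all $z\in\mathbb{R}^{\mathcal{K}}$: $$\begin{cases}D_{\mathcal{K}}z\in\operatorname{Im}\Phi^*+\operatorname{Im}D_{\mathcal{H}}\\ \langle z_J,v_J\rangle=0,\ J\in\mathcal{K}(w)\\ \langle z_J,v_J\rangle\ge0,\ J\in\mathcal{K}\setminus\mathcal{K}(w)\end{cases}\quad\Longrightarrow\quad z=0.$$ Then stable recovery occurs at $x_0$ if and only if $x_0$ is the unique (equivalently, strong) minimizer of the problem. Consequently, stable recovery occurs at $x_0$ if the following two conditions hold: $$W(x_0)\cap\mathcal{E}=\{0\}\qquad\text{and}\qquad\begin{cases}D_{\mathcal{K}}z\in\operatorname{Im}\Phi^*+\operatorname{Im}D_{\mathcal{H}}\\ \langle z_J,v_J\rangle\ge0,\ J\in\mathcal{K}\end{cases}\ \Longrightarrow\ z=0$$ (the latter for all $z\in\mathbb{R}^{\mathcal{K}}$).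
   Context: Setting: $\mathcal{J}$ is a partition of $\{1,\dots,p\}$ into $q$ groups; for $u\in\mathbb{R}^p$, $\|u\|_{1,2}=\sum_{J\in\mathcal{J}}\|u_J\|$, where $u_J\in\mathbb{R}^{|J|}$ is the subvector with indices in $J$ and $\|\cdot\|$ is the Euclidean norm. $D$ is an $n\times p$ real matrix, $D_J$ consists of the columns of $D$ with indices in $J$, $D^*$ and $D_J^*$ are transposes. $\Phi:\mathbb{R}^n\to\mathbb{R}^m$ is linear with adjoint $\Phi^*$, $y_0\in\mathbb{R}^m$. For $\mathcal{L}\subset\mathcal{J}$: $\mathbb{R}^{\mathcal{L}}$ is the set of tuples $w=(w_J)_{J\in\mathcal{L}}$, $w_J\in\mathbb{R}^{|J|}$; $D_{\mathcal{L}}w=\sum_{J\in\mathcal{L}}D_Jw_J$ and $D_{\mathcal{L}}^*x=(D_J^*x)_{J\in\mathcal{L}}$. Let $\bar y=D^*x_0$, $\mathcal{I}=\{J\in\mathcal{J}\mid\bar y_J\ne0\}$, $\mathcal{I}^c=\mathcal{J}\setminus\mathcal{I}$, and $e\in\mathbb{R}^p$ with $e_J=\bar y_J/\|\bar y_J\|$ for $J\in\mathcal{I}$ and $e_J=0$ for $J\in\mathcal{I}^c$. Then $\partial\|\cdot\|_{1,2}(\bar y)=\{z\in\mathbb{R}^p\mid z_{\mathcal{I}}=e_{\mathcal{I}},\ \|z_J\|\le1\ \forall J\in\mathcal{I}^c\}$, and $\Delta(x_0)=D(\partial\|\cdot\|_{1,2}(\bar y))\cap\operatorname{Im}\Phi^*$.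 $W(x_0)=\{w\in\operatorname{Ker}\Phi\mid\langle e_{\mathcal{I}},D_{\mathcal{I}}^*w\rangle+\sum_{J\in\mathcal{I}^c}\|D_J^*w\|=0\}$. For $w\in\mathbb{R}^n$, $\mathcal{K}(w)=\{J\in\mathcal{I}^c\mid D_J^*w\ne0\}$; for $w\in W(x_0)$ one has $\mathcal{K}(w)\subset\mathcal{K}$. $\mathcal{E}=\{w\in\mathbb{R}^n\mid D_J^*w\in\mathbb{R}\bar y_J,\ J\in\mathcal{I}\}$. Strong minimizer of the problem: $\Phi x_0=y_0$ and there are $\kappa,\varepsilon>0$ with $\|D^*x\|_{1,2}-\|D^*x_0\|_{1,2}\ge\frac{\kappa}{2}\|x-x_0\|^2$ for all $x$ with $\Phi x=y_0$, $\|x-x_0\|\le\varepsilon$. Stable recovery at $x_0$: for $y\in\mathbb{R}^m$, $\mu>0$ let $P(y,\mu)$ be the problem $\min_{x\in\mathbb{R}^n}\frac12\|\Phi x-y\|^2+\mu\|D^*x\|_{1,2}$. Stable recovery occurs at $x_0$ if for every constant $c>0$ there exist $K>0$ and $\bar\delta>0$ such that for all $\delta\in(0,\bar\delta)$, all $y$ with $\|y-y_0\|\le\delta$, and $\mu=c\delta$, every optimal solution $x(y,\mu)$ of $P(y,\mu)$ satisfies $\|x(y,\mu)-x_0\|\le K\delta$. *)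

(* Defs.v *)
From mathcomp Require Import all_boot all_order all_algebra.
From mathcomp Require Import boolp classical_sets reals.

Set Implicit Arguments.
Unset Strict Implicit.
Unset Printing Implicit Defensive.

Import Order.TTheory GRing.Theory Num.Theory.
Local Open Scope classical_set_scope.
Local Open Scope ring_scope.

(* The norm that MathComp-Analysis puts on matrices is the sup norm, hence the
   explicit Euclidean inner product and norm here. *)
Definition dotv (R : realType) (k : nat) (u v : 'cV[R]_k) : R :=
  \sum_i u i 0 * v i 0.

Definition enorm (R : realType) (k : nat) (u : 'cV[R]_k) : R :=
  Num.sqrt (dotv u u).

(* u_J and D_J; the indices in J are listed by [enum_val : 'I_#|J| -> 'I_p]. *)
Definition blk (R : realType) (p : nat) (u : 'cV[R]_p) (J : {set 'I_p}) :
    'cV[R]_#|J| :=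
  rowsub (fun k : 'I_#|J| => enum_val k) u.

Definition Dblk (R : realType) (n p : nat) (D : 'M[R]_(n, p))
    (J : {set 'I_p}) : 'M[R]_(n, #|J|) :=
  colsub (fun k : 'I_#|J| => enum_val k) D.

(* R^L, and D_L acting on it. *)
Definition tup (R : realType) (p : nat) (L : {set {set 'I_p}}) : Type :=
  forall J : {J : {set 'I_p} | J \in L}, 'cV[R]_#|val J|.

Definition Dtup (R : realType) (n p : nat) (D : 'M[R]_(n, p))
    (L : {set {set 'I_p}}) (w : tup R L) : 'cV[R]_n :=
  \sum_(J : {J : {set 'I_p} | J \in L}) Dblk D (val J) *m w J.

(* Adjoints are transposes: [D^T] is D^* and [Phi^T] is Phi^*. *)
Definition im_adj (R : realType) (m n : nat) (Phi : 'M[R]_(m, n)) :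
    set 'cV[R]_n :=
  range (fun a : 'cV[R]_m => Phi^T *m a).

(* Im Phi^* + Im D_L *)
Definition im_sum (R : realType) (m n p : nat) (Phi : 'M[R]_(m, n))
    (D : 'M[R]_(n, p)) (L : {set {set 'I_p}}) : set 'cV[R]_n :=
  [set x | exists a, exists b : tup R L, x = Phi^T *m a + Dtup D b].

Definition norm12 (R : realType) (p : nat) (P : {set {set 'I_p}})
    (u : 'cV[R]_p) : R :=
  \sum_(J in P) enorm (blk u J).

Definition subdiff (R : realType) (p : nat) (f : 'cV[R]_p -> R)
    (y : 'cV[R]_p) : set 'cV[R]_p :=
  [set z | forall u, f y + dotv z (u - y) <= f u].

Definition Delta (R : realType) (m n p : nat) (P : {set {set 'I_p}})
    (D : 'M[R]_(n, p)) (Phi : 'M[R]_(m, n)) (x0 : 'cV[R]_n) : set 'cV[R]_n :=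
  [set D *m z | z in subdiff (norm12 P) (D^T *m x0)] `&` im_adj Phi.

Definition active (R : realType) (n p : nat) (P : {set {set 'I_p}})
    (D : 'M[R]_(n, p)) (x0 : 'cV[R]_n) : {set {set 'I_p}} :=
  [set J in P | blk (D^T *m x0) J != 0]%SET.

Definition inactive (R : realType) (n p : nat) (P : {set {set 'I_p}})
    (D : 'M[R]_(n, p)) (x0 : 'cV[R]_n) : {set {set 'I_p}} :=
  P :\: active P D x0.

Definition evec (R : realType) (n p : nat) (P : {set {set 'I_p}})
    (D : 'M[R]_(n, p)) (x0 : 'cV[R]_n) : 'cV[R]_p :=
  \col_i (let J := finset.pblock P i in
          if J \in active P D x0
          then (D^T *m x0) i 0 / enorm (blk (D^T *m x0) J) else 0).

Definition Wset (R : realType) (m n p : nat) (P : {set {set 'I_p}})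
    (D : 'M[R]_(n, p)) (Phi : 'M[R]_(m, n)) (x0 : 'cV[R]_n) : set 'cV[R]_n :=
  [set w | Phi *m w = 0 /\
    \sum_(J in active P D x0)
        dotv (blk (evec P D x0) J) ((Dblk D J)^T *m w)
      + \sum_(J in inactive P D x0) enorm ((Dblk D J)^T *m w) = 0].

Definition Eset (R : realType) (n p : nat) (P : {set {set 'I_p}})
    (D : 'M[R]_(n, p)) (x0 : 'cV[R]_n) : set 'cV[R]_n :=
  [set w | forall J, J \in active P D x0 ->
    exists t : R, (Dblk D J)^T *m w = t *: blk (D^T *m x0) J].

(* K(w) *)
Definition Kdir (R : realType) (n p : nat) (P : {set {set 'I_p}})
    (D : 'M[R]_(n, p)) (x0 w : 'cV[R]_n) : {set {set 'I_p}} :=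
  [set J in inactive P D x0 | (Dblk D J)^T *m w != 0]%SET.

Definition Kset (R : realType) (n p : nat) (P : {set {set 'I_p}})
    (D : 'M[R]_(n, p)) (x0 : 'cV[R]_n) (v : 'cV[R]_p) : {set {set 'I_p}} :=
  [set J in inactive P D x0 | enorm (blk v J) == 1]%SET.

Definition Hset (R : realType) (n p : nat) (P : {set {set 'I_p}})
    (D : 'M[R]_(n, p)) (x0 : 'cV[R]_n) (v : 'cV[R]_p) : {set {set 'I_p}} :=
  [set J in inactive P D x0 | enorm (blk v J) < 1]%SET.

Definition minimizer (R : realType) (m n p : nat) (P : {set {set 'I_p}})
    (D : 'M[R]_(n, p)) (Phi : 'M[R]_(m, n)) (y0 : 'cV[R]_m)
    (x0 : 'cV[R]_n) : Prop :=
  Phi *m x0 = y0 /\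
  forall x, Phi *m x = y0 -> norm12 P (D^T *m x0) <= norm12 P (D^T *m x).

Definition unique_minimizer (R : realType) (m n p : nat)
    (P : {set {set 'I_p}}) (D : 'M[R]_(n, p)) (Phi : 'M[R]_(m, n))
    (y0 : 'cV[R]_m) (x0 : 'cV[R]_n) : Prop :=
  minimizer P D Phi y0 x0 /\ forall x, minimizer P D Phi y0 x -> x = x0.

Definition strong_minimizer (R : realType) (m n p : nat)
    (P : {set {set 'I_p}}) (D : 'M[R]_(n, p)) (Phi : 'M[R]_(m, n))
    (y0 : 'cV[R]_m) (x0 : 'cV[R]_n) : Prop :=
  Phi *m x0 = y0 /\
  exists kappa eps : R, [/\ 0 < kappa, 0 < eps &
    forall x, Phi *m x = y0 -> enorm (x - x0) <= eps ->
      kappa / 2 * enorm (x - x0) ^+ 2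
        <= norm12 P (D^T *m x) - norm12 P (D^T *m x0)].

Definition reg_objective (R : realType) (m n p : nat) (P : {set {set 'I_p}})
    (D : 'M[R]_(n, p)) (Phi : 'M[R]_(m, n)) (y : 'cV[R]_m) (mu : R)
    (x : 'cV[R]_n) : R :=
  2^-1 * enorm (Phi *m x - y) ^+ 2 + mu * norm12 P (D^T *m x).

Definition reg_solution (R : realType) (m n p : nat) (P : {set {set 'I_p}})
    (D : 'M[R]_(n, p)) (Phi : 'M[R]_(m, n)) (y : 'cV[R]_m) (mu : R)
    (x : 'cV[R]_n) : Prop :=
  forall x', reg_objective P D Phi y mu x <= reg_objective P D Phi y mu x'.

Definition stable_recovery (R : realType) (m n p : nat)
    (P : {set {set 'I_p}}) (D : 'M[R]_(n, p)) (Phi : 'M[R]_(m, n))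
    (y0 : 'cV[R]_m) (x0 : 'cV[R]_n) : Prop :=
  forall c : R, 0 < c ->
  exists K dbar : R, [/\ 0 < K, 0 < dbar &
    forall (delta : R) (y : 'cV[R]_m) (x : 'cV[R]_n),
      0 < delta < dbar -> enorm (y - y0) <= delta ->
      reg_solution P D Phi y (c * delta) x -> enorm (x - x0) <= K * delta].

(* Main.v *)
Require Import Defs.
From mathcomp Require Import all_boot all_order all_algebra.
From mathcomp Require Import boolp classical_sets reals.
From mathcomp Require Import topology normedtype sequences realfun.
From mathcomp Require Import ring lra.

(** Write [f x] for the group norm of [D^T x], [I] for the active blocks, and
    let [eta] satisfy [D v = Phi^T eta].

    Two of the implications come straight from the certificate [eta]. Shifting
    the data to [y0 + mu eta] makes every solution of the constrained problem
    optimal for the regularised one with parameter [mu]; since all these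
    solutions must then lie within [O(mu)] of [x0], stable recovery forces
    uniqueness ([stable_unique]). A strong minimizer is unique by convexity
    ([strong_unique]).

    The pivot of the other implications is that the intersection of [W] and [E]
    is trivial. Along a direction of [W] that lies in [E], every block norm is
    affine near [x0] and [f] is constant, so a unique minimizer excludes nonzero
    directions of this kind ([unique_trivial_WE]). Conversely, if [x0] is not a
    strong minimizer, the normalised steps violating quadratic growth
    accumulate at a direction of [W] along which the norms of the active blocks
    have no curvature, that is, a direction of [E] ([trivial_WE_strong]). Thus
    uniqueness, strong minimality and triviality of the intersection agree.

    It remains to go from uniqueness to stability. If stability fails, there are
    solutions [x_i] for noise levels [delta_i] with [|x_i - x0|] much larger
    than [delta_i]; comparing objective values at [x_i] and [x0]
    ([reg_solution_bounds]) shows that the normalised steps [w_i] tend to a unit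
    vector [w] of [W] and, by uniqueness, that [t_i = |x_i - x0|] tends to 0.
    Fermat's rule at [x_i] provides subgradients [z_i] at [D^T x_i] with [D z_i]
    in the range of [Phi^T] ([reg_optimality]). On the
    blocks of [I], the difference [r_i = z_i - v] is to first order [t_i] times
    the derivative along [w] of the normalised block; on those of [K] it points
    into the unit ball, of which [v] is there a boundary point. Divide [r_i] by
    [t_i] plus its size on [K] and pass to a limit [l]. Since [Phi w = 0] and
    [D^T w] vanishes on [H], [l] is orthogonal to [D^T w]; this kills either the
    curvature of the active norms along [w], so that [w] is in [E] and
    uniqueness is contradicted, or the part of [l] on [I]. In the second case
    [- l] is supported on [K], nonzero, and violates the nondegeneracy
    hypothesis ([nondegenerate_Eset]).

    For the sufficient condition, triviality of the intersection gives
    uniqueness, and the condition free of [w] implies the nondegeneracy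
    condition at every [w].

    Limits of bounded sequences are taken along an ultrafilter that refines the
    cofinite filter on the natural numbers, in place of subsequences. *)

Set Implicit Arguments.
Unset Strict Implicit.
Unset Printing Implicit Defensive.

Import Order.TTheory GRing.Theory Num.Theory.
Import numFieldNormedType.Exports.
Local Open Scope classical_set_scope.
Local Open Scope ring_scope.

(** * The Euclidean inner product and norm *)

Section Euclidean.
Variable R : realType.
Implicit Types k l : nat.

Lemma dotvE k (u v : 'cV[R]_k) : dotv u v = (u^T *m v) 0 0.
Proof. by rewrite mxE; apply: eq_bigr => i _; rewrite mxE. Qed.

Lemma dotvC k (u v : 'cV[R]_k) : dotv u v = dotv v u.
Proof. by apply: eq_bigr => i _; rewrite mulrC. Qed.

Lemma dotvDr k (u v w : 'cV[R]_k) : dotv u (v + w) = dotv u v + dotv u w.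
Proof. by rewrite !dotvE mulmxDr mxE. Qed.

Lemma dotvDl k (u v w : 'cV[R]_k) : dotv (v + w) u = dotv v u + dotv w u.
Proof. by rewrite dotvC dotvDr !(dotvC u). Qed.

Lemma dotvZr k a (u v : 'cV[R]_k) : dotv u (a *: v) = a * dotv u v.
Proof. by rewrite !dotvE -scalemxAr mxE. Qed.

Lemma dotvZl k a (u v : 'cV[R]_k) : dotv (a *: u) v = a * dotv u v.
Proof. by rewrite dotvC dotvZr dotvC. Qed.

Lemma dotvNr k (u v : 'cV[R]_k) : dotv u (- v) = - dotv u v.
Proof. by rewrite -scaleN1r dotvZr mulN1r. Qed.

Lemma dotvNl k (u v : 'cV[R]_k) : dotv (- u) v = - dotv u v.
Proof. by rewrite dotvC dotvNr dotvC. Qed.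

Lemma dotv0r k (u : 'cV[R]_k) : dotv u 0 = 0.
Proof. by rewrite -(scale0r u) dotvZr mul0r. Qed.

Lemma dotv0l k (u : 'cV[R]_k) : dotv 0 u = 0.
Proof. by rewrite dotvC dotv0r. Qed.

Definition dotv_linE :=
  (dotvDl, dotvDr, dotvNl, dotvNr, dotvZl, dotvZr, dotv0l, dotv0r).

Lemma dotv_adj k l (A : 'M[R]_(k, l)) u v :
  dotv (A *m u) v = dotv u (A^T *m v).
Proof. by rewrite !dotvE trmx_mul mulmxA. Qed.

Lemma dotv_ge0 k (u : 'cV[R]_k) : 0 <= dotv u u.
Proof. by apply: sumr_ge0 => i _; rewrite -expr2 sqr_ge0. Qed.

Lemma enorm_ge0 k (u : 'cV[R]_k) : 0 <= enorm u.
Proof. exact: sqrtr_ge0. Qed.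

Lemma sqr_enorm k (u : 'cV[R]_k) : enorm u ^+ 2 = dotv u u.
Proof. by rewrite sqr_sqrtr ?dotv_ge0. Qed.

Lemma sqr_entry_le k (u : 'cV[R]_k) i : (u i 0) ^+ 2 <= dotv u u.
Proof.
rewrite /dotv (bigD1 i) //= -expr2 lerDl; apply: sumr_ge0 => j _.
by rewrite -expr2 sqr_ge0.
Qed.

Lemma enorm_eq0 k (u : 'cV[R]_k) : (enorm u == 0) = (u == 0).
Proof.
apply/eqP/eqP => [u0|->]; last by rewrite /enorm dotv0l sqrtr0.
apply/matrixP => i j; rewrite ord1 mxE; apply/eqP; rewrite -sqrf_eq0.
have := sqr_entry_le u i; rewrite -sqr_enorm u0 expr0n /= => le0.
by rewrite eq_le le0 sqr_ge0.
Qed.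

Lemma enorm0 k : enorm (0 : 'cV[R]_k) = 0.
Proof. by apply/eqP; rewrite enorm_eq0. Qed.

Lemma enorm_gt0 k (u : 'cV[R]_k) : (0 < enorm u) = (u != 0).
Proof. by rewrite lt0r enorm_ge0 andbT enorm_eq0. Qed.

Lemma enormZ k a (u : 'cV[R]_k) : enorm (a *: u) = `|a| * enorm u.
Proof.
by rewrite /enorm dotvZl dotvZr mulrA -expr2 sqrtrM ?sqr_ge0 // sqrtr_sqr.
Qed.

Lemma enormN k (u : 'cV[R]_k) : enorm (- u) = enorm u.
Proof. by rewrite -scaleN1r enormZ normrN1 mul1r. Qed.

Lemma cauchy_schwarz k (u v : 'cV[R]_k) : dotv u v <= enorm u * enorm v.
Proof.
have [->|v0] := eqVneq v 0; first by rewrite dotv0r enorm0 mulr0.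
have [->|u0] := eqVneq u 0; first by rewrite dotv0l enorm0 mul0r.
have a0 : 0 < enorm u by rewrite enorm_gt0.
have b0 : 0 < enorm v by rewrite enorm_gt0.
have := dotv_ge0 (enorm v *: u - enorm u *: v).
rewrite !dotv_linE (dotvC v u) -!sqr_enorm; set a := enorm u; set b := enorm v.
set d := dotv u v => h.
have : 0 <= (a * b) * (a * b - d) by nra.
by rewrite pmulr_rge0 ?mulr_gt0 // subr_ge0.
Qed.

Lemma ler_enormD k (u v : 'cV[R]_k) : enorm (u + v) <= enorm u + enorm v.
Proof.
rewrite -(@ler_pXn2r _ 2) ?nnegrE ?addr_ge0 ?enorm_ge0 //.
rewrite sqr_enorm !dotv_linE (dotvC v u) sqrrD -!sqr_enorm.
have := cauchy_schwarz u v; lra.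
Qed.

Lemma sqr_enormDZ k (u v : 'cV[R]_k) t : enorm (u + t *: v) ^+ 2 =
  enorm u ^+ 2 + 2 * t * dotv u v + t ^+ 2 * enorm v ^+ 2.
Proof. by rewrite !sqr_enorm !dotv_linE (dotvC v u); ring. Qed.

Lemma entry_le_enorm k (u : 'cV[R]_k) i : `|u i 0| <= enorm u.
Proof. by rewrite -sqrtr_sqr ler_wsqrtr // sqr_entry_le. Qed.

(** Equality in Cauchy-Schwarz within the unit ball: a subgradient of the
    norm at a nonzero vector is that vector normalised. *)
Lemma dual_vector_unique k (z u : 'cV[R]_k) :
  u != 0 -> enorm z <= 1 -> dotv z u = enorm u -> z = (enorm u)^-1 *: u.
Proof.
move=> u0 z1 zu; have a0 : 0 < enorm u by rewrite enorm_gt0.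
apply/eqP; rewrite -subr_eq0 -enorm_eq0 -sqrf_eq0 eq_le sqr_ge0 andbT.
rewrite sqr_enorm !dotv_linE (dotvC u z) zu -!sqr_enorm.
set a := enorm u in a0 *.
rewrite mulVf ?gt_eqF // expr2 [a^-1 * (a * a)]mulrA mulVf ?gt_eqF // mul1r.
rewrite mulVf ?gt_eqF //; have := enorm_ge0 z; nra.
Qed.

Lemma enorm_normalized k (u : 'cV[R]_k) : u != 0 ->
  enorm ((enorm u)^-1 *: u) = 1.
Proof.
move=> u0; rewrite enormZ ger0_norm ?invr_ge0 ?enorm_ge0 //.
by rewrite mulVf // enorm_eq0.
Qed.

Lemma dotv_normalized k (u : 'cV[R]_k) : dotv ((enorm u)^-1 *: u) u = enorm u.
Proof.
have [->|u0] := eqVneq u 0; first by rewrite dotv0r enorm0.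
by rewrite dotvZl -sqr_enorm expr2 mulKf // enorm_eq0.
Qed.

End Euclidean.

(** * Block decomposition *)

Section Blocks.
Variables (R : realType) (n p : nat) (P : {set {set 'I_p}}).
Hypothesis partP : finset.partition P [set: 'I_p]%SET.
Implicit Types (J : {set 'I_p}) (S : {set {set 'I_p}}) (u v z : 'cV[R]_p).

Lemma blkE u J (k : 'I_#|J|) : blk u J k 0 = u (enum_val k) 0.
Proof. by rewrite mxE. Qed.

Lemma blkD u v J : blk (u + v) J = blk u J + blk v J.
Proof. by apply/matrixP => i j; rewrite !mxE. Qed.

Lemma blkZ a u J : blk (a *: u) J = a *: blk u J.
Proof. by apply/matrixP => i j; rewrite !mxE. Qed.

Lemma blkN u J : blk (- u) J = - blk u J.
Proof. by apply/matrixP => i j; rewrite !mxE. Qed.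

Lemma blk_adj (D : 'M[R]_(n, p)) w J : (Dblk D J)^T *m w = blk (D^T *m w) J.
Proof.
by apply/matrixP => i j; rewrite !mxE; apply: eq_bigr => l _; rewrite !mxE.
Qed.

Let trivP : finset.trivIset P.
Proof. by case/and3P: partP. Qed.

Lemma pblock_in (i : 'I_p) : finset.pblock P i \in P.
Proof. by apply: pblock_mem; case/and3P: partP => /eqP->; rewrite inE. Qed.

Lemma pblock_self (i : 'I_p) : i \in finset.pblock P i.
Proof. by rewrite mem_pblock; case/and3P: partP => /eqP->; rewrite inE. Qed.

Lemma pblock_enum J (k : 'I_#|J|) : J \in P -> finset.pblock P (enum_val k) = J.
Proof. by move=> JP; apply: def_pblock => //; exact: enum_valP. Qed.

Lemma sum_blocks (V : nmodType) (F : 'I_p -> V) :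
  \sum_i F i = \sum_(J in P) \sum_(k < #|J|) F (enum_val k).
Proof.
have -> : \sum_i F i = \sum_(i in finset.cover P) F i.
  by case/and3P: partP => /eqP-> _ _; apply: eq_bigl => i; rewrite inE.
by rewrite big_trivIset //; apply: eq_bigr => J _; rewrite big_enum_val.
Qed.

Lemma dotv_blocks u v : dotv u v = \sum_(J in P) dotv (blk u J) (blk v J).
Proof.
rewrite /dotv sum_blocks; apply: eq_bigr => J _; apply: eq_bigr => k _.
by rewrite !mxE.
Qed.

Lemma mulmx_blocks (D : 'M[R]_(n, p)) z :
  D *m z = \sum_(J in P) Dblk D J *m blk z J.
Proof.
apply/matrixP => i j; rewrite mxE sum_blocks summxE; apply: eq_bigr => J _.
by rewrite mxE; apply: eq_bigr => k _; rewrite !mxE.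
Qed.

Lemma blk_inj u v : (forall J, J \in P -> blk u J = blk v J) -> u = v.
Proof.
move=> uv; apply/matrixP => i j; rewrite ord1.
have := uv _ (pblock_in i) => /matrixP/(_ (enum_rank_in (pblock_self i) i) 0).
by rewrite !mxE enum_rankK_in // pblock_self.
Qed.

(** Restriction to the blocks of [S]; a matrix, so that the range of [D] on
    those blocks is a column space. *)
Definition mask S : 'M[R]_p :=
  diag_mx (\row_i (finset.pblock P i \in S)%:R).

Lemma blk_mask S z J : J \in P ->
  blk (mask S *m z) J = if J \in S then blk z J else 0.
Proof.
move=> JP; apply/matrixP => k j; rewrite ord1 mxE mul_diag_mx !mxE.
by rewrite pblock_enum //; case: ifP => _; rewrite ?mxE ?mul1r ?mul0r.
Qed.

Lemma Dtup_mask (D : 'M[R]_(n, p)) S z : {subset S <= P} ->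
  Dtup D (fun J : {J | J \in S} => blk z (val J)) = D *m (mask S *m z).
Proof.
move=> SP; rewrite mulmx_blocks.
transitivity (\sum_(J in S) Dblk D J *m blk z J).
  by rewrite [RHS]big_sub.
rewrite [RHS](bigID (mem S)) /= [X in _ + X]big1 ?addr0.
  rewrite [RHS](eq_bigl (mem S)); last first.
    by move=> J /=; apply: andb_idl => /SP.
  by apply: eq_bigr => J JS; rewrite blk_mask ?SP // ifT.
by move=> J /andP[JP /negPf JS]; rewrite blk_mask // JS mulmx0.
Qed.

(** The blocks partition the coordinates, so they can be prescribed
    independently. *)
Lemma assemble (F : forall J, 'cV[R]_#|J|) :
  exists z : 'cV[R]_p, forall J, J \in P -> blk z J = F J.
Proof.
exists (\col_i F (finset.pblock P i) (enum_rank_in (pblock_self i) i) 0).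
move=> J JP; apply/matrixP => k j; rewrite ord1 !mxE.
move: (pblock_self (enum_val k)); rewrite pblock_enum // => kJ.
by rewrite enum_valK_in.
Qed.

End Blocks.

(** * Subgradients and directional derivatives of the group norm *)

Section NormSubgradient.
Variables (R : realType) (k : nat).
Implicit Types y u z : 'cV[R]_k.

(** The subdifferential of the Euclidean norm at [y], described by duality: the
    two conditions are equivalent to the subgradient inequality. *)
Definition norm_subgrad y z := enorm z <= 1 /\ dotv z y = enorm y.

(** The one-sided directional derivative of the Euclidean norm at [y] along
    [u], which is also the support function of the subdifferential at [y]. *)
Definition norm_dir y u : R :=
  if y == 0 then enorm u else (enorm y)^-1 * dotv y u.

Lemma norm_subgrad_le y z u :
  norm_subgrad y z -> enorm y + dotv z u <= enorm (y + u).
Proof.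
move=> [z1 <-]; rewrite -dotvDr (le_trans (cauchy_schwarz _ _)) //.
by rewrite ler_piMl ?enorm_ge0.
Qed.

Lemma norm_subgrad_active y z :
  y != 0 -> norm_subgrad y z -> z = (enorm y)^-1 *: y.
Proof. by move=> y0 [z1 zy]; exact: dual_vector_unique. Qed.

Lemma norm_subgrad_dir y z u : norm_subgrad y z -> dotv z u <= norm_dir y u.
Proof.
move=> syz; rewrite /norm_dir; case: eqVneq => [y0|y0].
  by have := norm_subgrad_le u syz; rewrite y0 enorm0 !add0r.
by rewrite (norm_subgrad_active y0 syz) dotvZl.
Qed.

Lemma norm_dir_attained y u :
  exists z, norm_subgrad y z /\ dotv z u = norm_dir y u.
Proof.
rewrite /norm_subgrad /norm_dir; case: eqVneq => [->|y0].
  exists ((enorm u)^-1 *: u); rewrite dotv_normalized dotv0r enorm0.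
  have [->|u0] := eqVneq u 0; first by rewrite scaler0 enorm0.
  by rewrite enorm_normalized.
exists ((enorm y)^-1 *: y).
by rewrite enorm_normalized // dotv_normalized dotvZl.
Qed.

Lemma norm_dir_le y u (t : R) : 0 <= t ->
  enorm y + t * norm_dir y u <= enorm (y + t *: u).
Proof.
move=> t0; have [z [syz <-]] := norm_dir_attained y u.
by rewrite -dotvZr; exact: norm_subgrad_le.
Qed.

(** The second-order remainder of the norm, obtained from the
    arithmetic-geometric inequality [2 a b <= a^2 + b^2] with [a = enorm y] and
    [b = enorm (y + t *: u)]. *)
Lemma norm_dir_upper y u : exists2 C : R, 0 <= C & forall t : R, 0 <= t ->
  enorm (y + t *: u) <= enorm y + t * norm_dir y u + C * t ^+ 2.
Proof.
rewrite /norm_dir; case: eqVneq => [->|y0].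
  exists 0 => // t t0.
  by rewrite add0r enormZ ger0_norm // enorm0 mul0r add0r addr0.
have a0 : 0 < enorm y by rewrite enorm_gt0.
exists (2^-1 * (enorm y)^-1 * enorm u ^+ 2) => [|t t0].
  by rewrite !mulr_ge0 ?invr_ge0 ?sqr_ge0 ?enorm_ge0.
have := sqr_enorm (y + t *: u).
rewrite !dotv_linE (dotvC u y) -!sqr_enorm.
set b := enorm (y + _); set a := enorm y in a0 *; set c := enorm u.
set d := dotv y u => bE.
have -> : a + t * (a^-1 * d) + 2^-1 * a^-1 * c ^+ 2 * t ^+ 2 =
    (a ^+ 2 + b ^+ 2) / (2 * a).
  by rewrite bE; field; rewrite gt_eqF.
by rewrite ler_pdivlMr ?mulr_gt0 //; have := sqr_ge0 (a - b); clear; nra.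
Qed.

End NormSubgradient.

Section GroupNorm.
Variables (R : realType) (p : nat) (P : {set {set 'I_p}}).
Hypothesis partP : finset.partition P [set: 'I_p]%SET.
Implicit Types (J : {set 'I_p}) (y u z : 'cV[R]_p).

Definition group_subgrad y z :=
  forall J, J \in P -> norm_subgrad (blk y J) (blk z J).

Definition group_dir y u : R := \sum_(J in P) norm_dir (blk y J) (blk u J).

Lemma group_subgrad_le y z u :
  group_subgrad y z -> norm12 P y + dotv z u <= norm12 P (y + u).
Proof.
move=> syz; rewrite (dotv_blocks partP) -big_split /=.
by apply: ler_sum => J JP; rewrite blkD; exact/norm_subgrad_le/syz.
Qed.

(** The subdifferential of a separable function is a product: testing the
    subgradient inequality with increments supported on one block isolates that
    block. The increments [z] and [- y] then give the two dual conditions. *)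
Lemma subdiff_group_subgrad y z : subdiff (norm12 P) y z -> group_subgrad y z.
Proof.
move=> syz J JP.
have test u : enorm (blk y J) + dotv (blk z J) (blk u J) <=
    enorm (blk y J + blk u J).
  have := syz (y + mask R P [set J]%SET *m u).
  rewrite addrAC subrr add0r (dotv_blocks partP) /norm12.
  rewrite (bigD1 J) //= [X in _ + X <= _](bigD1 J) //= [leRHS](bigD1 J) //=.
  rewrite blkD !(blk_mask partP) // inE eqxx.
  rewrite [X in _ + (_ + X)]big1 ?addr0; last first.
    by move=> L /andP[LP /negPf LJ]; rewrite (blk_mask partP) // inE LJ dotv0r.
  rewrite [X in _ <= _ + X](eq_bigr (fun L => enorm (blk y L))); last first.
    move=> L /andP[LP /negPf LJ].
    by rewrite blkD (blk_mask partP) // inE LJ addr0.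
  lra.
have z1 : enorm (blk z J) <= 1.
  have := test z; rewrite -sqr_enorm.
  move=> /le_trans/(_ (ler_enormD _ _)); rewrite lerD2l.
  by have := enorm_ge0 (blk z J); set a := enorm _; clear; nra.
split=> //; apply/eqP; rewrite eq_le; apply/andP; split.
  rewrite (le_trans (cauchy_schwarz _ _)) // ler_piMl ?enorm_ge0 //.
have := test (- y); rewrite !blkN dotvNr subrr enorm0; lra.
Qed.

Lemma group_subgrad_dir y z u :
  group_subgrad y z -> dotv z u <= group_dir y u.
Proof.
move=> syz; rewrite (dotv_blocks partP); apply: ler_sum => J JP.
exact/norm_subgrad_dir/syz.
Qed.

Lemma group_dir_attained y u :
  exists2 z, group_subgrad y z & dotv z u = group_dir y u.
Proof.
have [z zE] := assemble partP
  (fun J => sval (cid (norm_dir_attained (blk y J) (blk u J)))).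
exists z => [J JP|].
  by rewrite zE //; case: cid => ? [].
rewrite (dotv_blocks partP); apply: eq_bigr => J JP.
by rewrite zE //; case: cid => ? [].
Qed.

Lemma group_dir_le y u (t : R) : 0 <= t ->
  norm12 P y + t * group_dir y u <= norm12 P (y + t *: u).
Proof.
move=> t0; rewrite mulr_sumr -big_split /=; apply: ler_sum => J JP.
by rewrite blkD blkZ norm_dir_le.
Qed.

Lemma group_dir_upper y u : exists2 C : R, 0 <= C & forall t : R, 0 <= t ->
  norm12 P (y + t *: u) <= norm12 P y + t * group_dir y u + C * t ^+ 2.
Proof.
pose C J := s2val (cid2 (norm_dir_upper (blk y J) (blk u J))).
exists (\sum_(J in P) C J) => [|t t0].
  by apply: sumr_ge0 => J _; rewrite /C; case: cid2.
rewrite mulr_sumr mulr_suml -!big_split /=; apply: ler_sum => J JP.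
by rewrite blkD blkZ /C; case: cid2 => c c0 /= /(_ _ t0).
Qed.

Lemma norm12_convex y u (t : R) : 0 <= t <= 1 ->
  norm12 P (y + t *: u) <= (1 - t) * norm12 P y + t * norm12 P (y + u).
Proof.
move=> /andP[t0 t1]; rewrite !mulr_sumr -big_split /=; apply: ler_sum => J JP.
rewrite !blkD !blkZ.
have -> : blk y J + t *: blk u J =
    (1 - t) *: blk y J + t *: (blk y J + blk u J).
  by rewrite scalerBl scale1r scalerDr -addrA addKr.
by rewrite (le_trans (ler_enormD _ _)) // !enormZ !ger0_norm // subr_ge0.
Qed.

End GroupNorm.

(** * Limits along an ultrafilter *)

Section UltraLimit.
Context {R : realType} {U : set_system nat} {UU : UltraFilter U}.

Lemma ultra_fmap (T : Type) (f : nat -> T) : UltraFilter (f @ U).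
Proof.
split=> [|G GF fUG]; first exact: fmap_proper_filter.
rewrite predeqE => A; split; last exact: fUG.
move=> GA; have [//|UnA] := in_ultra_setVsetC (f @^-1` A) UU.
have /fUG GnA : (f @ U) (~` A) by [].
by have [a [Aa nAa]] := @filter_ex _ _ GF _ (@filterI _ _ GF _ _ GA GnA).
Qed.

Lemma ultra_cvg_sum (I : finType) (A : pred I) (f : I -> nat -> R)
    (l : I -> R) : (forall i, A i -> f i @ U --> l i) ->
  (fun n => \sum_(i | A i) f i n) @ U --> \sum_(i | A i) l i.
Proof. by move=> fl; apply: cvg_big => //; exact: add_continuous. Qed.

Lemma ultra_bounded_cvg (f : nat -> R) (M : R) :
  (\forall n \near U, `|f n| <= M) -> exists l : R, f @ U --> l.
Proof.
move=> fM; have := @segment_compact R (- M) M.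
rewrite compact_ultra => /(_ _ (ultra_fmap f))[|l [_ fl]]; last by exists l.
by apply: filterS fM => n /=; rewrite in_itv /= ler_norml.
Qed.

Section VectorLimit.
Variable k : nat.
Implicit Types (x y : nat -> 'cV[R]_k) (l : 'cV[R]_k).

Definition vcvg x l := forall i, (fun n => x n i 0) @ U --> l i 0.

Lemma vcvg_cst l : vcvg (fun=> l) l.
Proof. by move=> i; exact: cvg_cst. Qed.

Lemma vcvgD x y l1 l2 : vcvg x l1 -> vcvg y l2 ->
  vcvg (fun n => x n + y n) (l1 + l2).
Proof.
move=> xl yl i; rewrite mxE; under eq_fun do rewrite mxE.
exact: cvgD.
Qed.

Lemma vcvgN x l : vcvg x l -> vcvg (fun n => - x n) (- l).
Proof.
by move=> xl i; rewrite mxE; under eq_fun do rewrite mxE; exact: cvgN.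
Qed.

Lemma vcvgB x y l1 l2 : vcvg x l1 -> vcvg y l2 ->
  vcvg (fun n => x n - y n) (l1 - l2).
Proof. by move=> xl yl; apply: vcvgD => //; exact: vcvgN. Qed.

Lemma vcvgZ (a : nat -> R) x (b : R) l : a @ U --> b -> vcvg x l ->
  vcvg (fun n => a n *: x n) (b *: l).
Proof.
by move=> ab xl i; rewrite mxE; under eq_fun do rewrite mxE; exact: cvgM.
Qed.

Lemma vcvg_near x y l : (\forall n \near U, x n = y n) ->
  vcvg x l -> vcvg y l.
Proof.
move=> xy xl i; apply: cvg_trans (xl i); apply: near_eq_cvg.
by apply: filterS xy => n ->.
Qed.

Lemma vcvg_unique x l1 l2 : vcvg x l1 -> vcvg x l2 -> l1 = l2.
Proof.
move=> x1 x2; apply/matrixP => i j; rewrite ord1.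
exact: (cvg_unique _ (x1 i) (x2 i)).
Qed.

Lemma cvg_dotv x y l1 l2 : vcvg x l1 -> vcvg y l2 ->
  (fun n => dotv (x n) (y n)) @ U --> dotv l1 l2.
Proof.
move=> xl yl; rewrite /dotv; apply: ultra_cvg_sum => i _; exact: cvgM.
Qed.

Lemma cvg_enorm x l : vcvg x l -> (fun n => enorm (x n)) @ U --> enorm l.
Proof.
move=> xl; rewrite /enorm.
apply: (@continuous_cvg _ _ _ U _ (fun n => dotv (x n) (x n)) Num.sqrt).
  exact: sqrt_continuous.
exact: cvg_dotv.
Qed.

Lemma vcvg_entries x : (forall i, exists a : R, (fun n => x n i 0) @ U --> a) ->
  exists l, vcvg x l.
Proof.
move=> /choice[a xa]; exists (\col_i a i) => i; rewrite mxE; exact: xa.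
Qed.

Lemma ultra_bounded_vcvg x (M : R) :
  (\forall n \near U, enorm (x n) <= M) -> exists l, vcvg x l.
Proof.
move=> xM; apply: vcvg_entries => i; apply: (@ultra_bounded_cvg _ M).
by apply: filterS xM => n; apply: le_trans; exact: entry_le_enorm.
Qed.

End VectorLimit.

Lemma vcvg_mulmx k l (A : 'M[R]_(k, l)) (x : nat -> 'cV[R]_l) y :
  vcvg x y -> vcvg (fun n => A *m x n) (A *m y).
Proof.
move=> xy i; rewrite mxE; under eq_fun do rewrite mxE.
by apply: ultra_cvg_sum => j _; apply: cvgM; [exact: cvg_cst|exact: xy].
Qed.

Lemma vcvg_blk p (x : nat -> 'cV[R]_p) y (J : {set 'I_p}) :
  vcvg x y -> vcvg (fun n => blk (x n) J) (blk y J).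
Proof.
by move=> xy i; rewrite blkE; under eq_fun do rewrite blkE; exact: xy.
Qed.

(** A column space is closed: it is the kernel of its cokernel matrix. *)
Lemma vcvg_range k l (A : 'M[R]_(k, l)) (x : nat -> 'cV[R]_k) y :
  (forall n, exists a, x n = A *m a) -> vcvg x y -> exists a, y = A *m a.
Proof.
move=> xA xy; set B := (cokermx A^T)^T.
have Bx n : B *m x n = 0.
  have [a ->] := xA n; rewrite -[A in B *m (A *m _)]trmxK mulmxA -trmx_mul.
  by rewrite mulmx_coker trmx0 mul0mx.
have By : B *m y = 0.
  apply: (vcvg_unique (vcvg_mulmx (A := B) xy)).
  by apply: vcvg_near (@vcvg_cst k 0); apply: nearW => n.
have : (y^T <= A^T)%MS.
  by rewrite submxE; apply/eqP; rewrite -[_ *m _]trmxK trmx_mul !trmxK By trmx0.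
move=> /submxP[a yE]; exists a^T.
by rewrite -[LHS]trmxK yE trmx_mul trmxK.
Qed.

(** An ultrafilter decides every set of indices, so a nonnegative sequence that
    does not tend to 0 is bounded away from 0 along it. *)
Lemma ultra_nle_cvg0 (t : nat -> R) : (forall n, 0 <= t n) ->
  ~ (t @ U --> (0 : R)) -> exists2 e : R, 0 < e & \forall n \near U, e <= t n.
Proof.
move=> t0 nt; apply: contrapT => h; apply: nt; apply/cvgrPdist_lt => e e0.
have [//|Un] := in_ultra_setVsetC [set n | `|0 - t n| < e] UU.
exfalso; apply: h; exists e => //; apply: filterS Un => n /= /negP.
by rewrite -leNgt sub0r normrN ger0_norm.
Qed.

End UltraLimit.

Arguments vcvg {R} U {k} x l.
Arguments vcvg_cst {R U UU k} l.
Arguments vcvg_mulmx {R U UU k l} A {x y}.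
Arguments vcvg_blk {R U p x y} J.

Section UltraOnNat.
Variables (R : realType).

Lemma ex_ultra : exists2 U : set_system nat, UltraFilter U & \oo `<=` U.
Proof. by have [U [UU ooU]] := @ultraFilterLemma nat \oo _; exists U. Qed.

(** Existence of a minimizer on a bounded set that is closed under ultrafilter
    limits: the limit of a minimizing sequence. *)
Lemma compact_argmin k (S : set 'cV[R]_k) (h : 'cV[R]_k -> R) (M : R) :
  S !=set0 -> (forall z, S z -> enorm z <= M) -> (forall z, 0 <= h z) ->
  (forall U, UltraFilter U -> forall x l, (forall n, S (x n)) ->
     vcvg U x l -> S l /\ (fun n => h (x n)) @ U --> h l) ->
  exists2 z, S z & forall z', S z' -> h z <= h z'.
Proof.
move=> [z0 Sz0] SM h0 Slim.
have [U UU ooU] := ex_ultra.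
pose m := inf (h @` S).
have hm : has_inf (h @` S).
  by split; [exists (h z0), z0|exists 0 => _ [z _ <-]].
have /choice[x xP] n : exists z, S z /\ h z < m + n.+1%:R^-1.
  have [|_ [z Sz <-] zm] := @inf_adherent _ (h @` S) n.+1%:R^-1 _ hm.
    by rewrite invr_gt0.
  by exists z.
have [|z xz] := @ultra_bounded_vcvg R U UU k x M.
  by apply: nearW => n; apply: SM; case: (xP n).
have [Sz hz] := Slim U UU x z (fun n => (xP n).1) xz.
exists z => // z' Sz'; apply: (@le_trans _ _ m); last first.
  by apply: ge_inf; [case: hm|exists z'].
have mU : (fun n : nat => m + n.+1%:R^-1) @ U --> m.
  rewrite -[X in _ --> X]addr0; apply: cvgD; first exact: cvg_cst.
  by apply: cvg_trans (cvg_harmonic); exact: (cvg_app _ ooU).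
apply: (ler_cvg_to hz mU); apply: nearW => n; apply: ltW.
by case: (xP n).
Qed.

End UltraOnNat.

(** * Fermat's rule for the regularised problem *)

Section Optimality.
Variables (R : realType) (m n p : nat) (P : {set {set 'I_p}}).
Hypothesis partP : finset.partition P [set: 'I_p]%SET.
Variables (D : 'M[R]_(n, p)) (Phi : 'M[R]_(m, n)).

Lemma le0_of_linear_bound (a C : R) : 0 <= C ->
  (forall t : R, 0 < t <= 1 -> a <= C * t) -> a <= 0.
Proof.
move=> C0 aC; rewrite leNgt; apply/negP => a0.
have aC0 : 0 < a + C by rewrite ltr_pwDl.
have /aC : 0 < a / (a + C) <= 1.
  by rewrite divr_gt0 //= ler_pdivrMr // mul1r lerDl.
by rewrite mulrA ler_pdivlMr // mulrC ler_pM2r // gerDr leNgt a0.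
Qed.

(** Together with convexity and closedness below, this provides the projection
    onto the image of the subdifferential used in [subgrad_chain]. *)
Lemma group_subgrad_bounded y z :
  group_subgrad P y z -> enorm z <= Num.sqrt (#|P|%:R : R).
Proof.
move=> yz; apply: ler_wsqrtr; rewrite (dotv_blocks partP).
rewrite -sum1_card natr_sum; apply: ler_sum => J JP.
by rewrite -sqr_enorm expr_le1 ?enorm_ge0 //; case: (yz J JP).
Qed.

Lemma group_subgrad_convex y z z' (t : R) : 0 <= t <= 1 ->
  group_subgrad P y z -> group_subgrad P y z' ->
  group_subgrad P y (z + t *: (z' - z)).
Proof.
move=> /andP[t0 t1] yz yz' J JP; have [z1 zy] := yz J JP.
have [z1' zy'] := yz' J JP; rewrite !(blkD, blkZ, blkN); split; last first.
  by rewrite !dotv_linE zy zy' subrr mulr0 addr0.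
have -> : blk z J + t *: (blk z' J - blk z J) =
    (1 - t) *: blk z J + t *: blk z' J.
  by rewrite scalerBl scale1r scalerBr addrA addrAC.
rewrite (le_trans (ler_enormD _ _)) // !enormZ !ger0_norm ?subr_ge0 //; nra.
Qed.

Lemma group_subgrad_closed (U : set_system nat) (UU : UltraFilter U) y
    (z : nat -> 'cV[R]_p) l :
  (forall k, group_subgrad P y (z k)) -> vcvg U z l -> group_subgrad P y l.
Proof.
move=> yz zl J JP; have zJ := vcvg_blk J zl; split.
  apply: (ler_cvg_to (cvg_enorm zJ) (cvg_cst (1 : R))); apply: nearW => k.
  by case: (yz k J JP).
have zy : (fun k => dotv (blk (z k) J) (blk y J)) = fun=> enorm (blk y J).
  by apply/funext => k; case: (yz k J JP).
have yl : (fun=> enorm (blk y J)) @ U --> dotv (blk l J) (blk y J).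
  by rewrite -zy; apply: cvg_dotv zJ (vcvg_cst _).
exact: (cvg_unique _ yl (cvg_cst _)).
Qed.

(** The chain rule for the subdifferential of [f]. The image under [D] of the
    subdifferential of the group norm is compact and convex; if its point
    nearest to [s] were not [s] itself, the difference [d] would separate [s]
    from the image, whereas the support function of the image along [d] is the
    directional derivative of [f], which dominates [dotv s d]. *)
Lemma subgrad_chain x s :
  (forall d, dotv s d <= group_dir P (D^T *m x) (D^T *m d)) ->
  exists2 z, group_subgrad P (D^T *m x) z & D *m z = s.
Proof.
move=> sdir; set y := D^T *m x.
have [z0 yz0 _] := group_dir_attained partP y 0.
have [||||z yz zmin] := @compact_argmin R p (group_subgrad P y)
    (fun z => enorm (s - D *m z)) (Num.sqrt (#|P|%:R : R)).
- by exists z0.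
- by move=> z; exact: group_subgrad_bounded.
- by move=> z; exact: enorm_ge0.
- move=> U UU z l yz zl; split; first exact: group_subgrad_closed yz zl.
  by apply/cvg_enorm/vcvgB; [exact: vcvg_cst|exact: vcvg_mulmx].
exists z => //; have [d dE] : {d | d = s - D *m z} by exists (s - D *m z).
have proj z' : group_subgrad P y z' -> dotv d (D *m (z' - z)) <= 0.
  move=> yz'; set e := D *m (z' - z).
  apply: (@le0_of_linear_bound _ (2^-1 * enorm e ^+ 2)).
    by rewrite mulr_ge0 ?invr_ge0 ?sqr_ge0.
  move=> t /andP[t0 t1].
  have /zmin : group_subgrad P y (z + t *: (z' - z)).
    by apply: group_subgrad_convex; rewrite ?(ltW t0).
  rewrite mulmxDr -scalemxAr opprD addrA -dE -/e.
  rewrite -(@ler_pXn2r _ 2) ?nnegrE ?enorm_ge0 // -scaleNr sqr_enormDZ => h.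
  have : 0 <= t * (2^-1 * enorm e ^+ 2 * t - dotv d e) by nra.
  by rewrite pmulr_rge0 // subr_ge0.
have [z' yz' z'd] := group_dir_attained partP y (D^T *m d).
have dd : dotv d d = dotv s d - dotv (D *m z) d.
  by rewrite -dotvNl -dotvDl dE.
apply/eqP; rewrite eq_sym -subr_eq0 -dE -enorm_eq0 -sqrf_eq0.
rewrite eq_le sqr_ge0 andbT sqr_enorm dd.
have := proj _ yz'; have := sdir d; rewrite -/y -z'd.
rewrite mulmxBr dotvDr dotvNr !(dotvC d) (dotv_adj D z'); lra.
Qed.

(** Moving from a solution along [d] changes the objective by a linear term plus
    [O(t^2)], so the gradient of the fidelity term is dominated by the
    directional derivative of [f] in every direction. *)
Lemma reg_optimality y (mu : R) x : 0 < mu -> reg_solution P D Phi y mu x ->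
  exists2 z, group_subgrad P (D^T *m x) z &
    D *m z = Phi^T *m (mu^-1 *: (y - Phi *m x)).
Proof.
move=> mu0 xsol; apply: subgrad_chain => d.
rewrite dotv_adj trmxK dotvZl ler_pdivrMl //.
set g := group_dir _ _ _; rewrite -subr_le0.
have [C C0 Cup] := group_dir_upper P (D^T *m x) (D^T *m d).
apply: (@le0_of_linear_bound _ (2^-1 * enorm (Phi *m d) ^+ 2 + mu * C)).
  by rewrite addr_ge0 // mulr_ge0 ?invr_ge0 ?sqr_ge0 // ltW.
move=> t /andP[t0 _];
have := xsol (x + t *: d); have := Cup t (ltW t0); rewrite -/g.
rewrite /reg_objective !mulmxDr -!scalemxAr (addrAC (Phi *m x)).
set r := Phi *m x - y; rewrite -(opprB (Phi *m x) y) -/r dotvNl.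
rewrite sqr_enormDZ.
set f1 := norm12 P _; set f2 := norm12 P _ => f1f2.
have := ler_wpM2l (ltW mu0) f1f2.
move: (enorm (Phi *m d) ^+ 2) (dotv r _) (enorm r ^+ 2).
move=> a b e h1 h2.
have : 0 <= t * ((2^-1 * a + mu * C) * t - (- b - mu * g)) by nra.
by rewrite pmulr_rge0 // subr_ge0.
Qed.

End Optimality.

(** * Limits of norms and of their subgradients *)

Section NormLimits.
Context {R : realType} {U : set_system nat} {UU : UltraFilter U}.

Lemma cvg_norm_dir k (y : 'cV[R]_k) u l : vcvg U u l ->
  (fun i => norm_dir y (u i)) @ U --> norm_dir y l.
Proof.
move=> ul; rewrite /norm_dir; case: eqVneq => _; first exact: cvg_enorm.
by apply: cvgM; [exact: cvg_cst|apply: cvg_dotv ul; exact: vcvg_cst].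
Qed.

Lemma cvg_group_dir p (P : {set {set 'I_p}}) (y : 'cV[R]_p) u l :
  vcvg U u l -> (fun i => group_dir P y (u i)) @ U --> group_dir P y l.
Proof.
by move=> ul; apply: ultra_cvg_sum => J _; apply/cvg_norm_dir/vcvg_blk.
Qed.

Lemma cvg_mul0l (a b : nat -> R) (l : R) :
  a @ U --> (0 : R) -> b @ U --> l -> (fun i => a i * b i) @ U --> (0 : R).
Proof. by move=> a0 bl; rewrite -(mul0r l); exact: cvgM. Qed.

Lemma vcvg_line k (y : 'cV[R]_k) (t : nat -> R) u l : t @ U --> (0 : R) ->
  vcvg U u l -> vcvg U (fun i => y + t i *: u i) y.
Proof.
move=> t0 ul; rewrite -[X in vcvg _ _ X]addr0 -(scale0r l).
by apply: vcvgD; [exact: vcvg_cst|exact: vcvgZ].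
Qed.

Section ActiveBlock.
Variables (k : nat) (y : 'cV[R]_k) (t : nat -> R) (u : nat -> 'cV[R]_k).
Variable l : 'cV[R]_k.
Hypotheses (y0 : y != 0) (tpos : forall i, 0 < t i) (t0 : t @ U --> (0 : R)).
Hypothesis ul : vcvg U u l.

Let a := enorm y.
Let a0 : 0 < a. Proof. by rewrite enorm_gt0. Qed.

(** For nonzero [y] the coefficient is [dotv y w / enorm y ^+ 2], so this is the
    component of [w] orthogonal to [y]; it is written with [norm_dir] because
    the slope of the norm is the quantity that the lemmas below follow. *)
Definition orth_part (w : 'cV[R]_k) : 'cV[R]_k :=
  w - (norm_dir y w / enorm y) *: y.

Lemma dotv_orth_part w :
  dotv (orth_part w) w = enorm w ^+ 2 - norm_dir y w ^+ 2.
Proof.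
rewrite /orth_part /norm_dir (negPf y0) -/a dotvDl dotvNl dotvZl sqr_enorm.
by field; rewrite gt_eqF.
Qed.

Lemma sqr_enorm_orth_part w :
  enorm (orth_part w) ^+ 2 = enorm w ^+ 2 - norm_dir y w ^+ 2.
Proof.
rewrite /orth_part -scaleNr sqr_enormDZ (dotvC w y) /norm_dir (negPf y0) -/a.
by field; rewrite gt_eqF.
Qed.

(** The second derivative of the norm at [y] along [l] is
    [enorm (orth_part l) ^+ 2 / enorm y]; growth of order [o(t^2)] beyond the
    linear term forces it to vanish. With [d] the slope [norm_dir y u], the
    proof factors [t^2 (enorm u ^+ 2 - d ^+ 2)], which is
    [enorm (y + t u) ^+ 2 - (enorm y + t d) ^+ 2]. *)
Lemma norm_flat_limit (b : nat -> R) : b @ U --> (0 : R) ->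
  (forall i, enorm (y + t i *: u i) - a - t i * norm_dir y (u i)
    <= b i * t i ^+ 2) ->
  orth_part l = 0.
Proof.
move=> b0 ub; apply/eqP; rewrite -enorm_eq0 -sqrf_eq0 eq_le sqr_ge0 andbT.
rewrite sqr_enorm_orth_part.
pose d i := norm_dir y (u i); pose N i := enorm (y + t i *: u i).
have dl : d @ U --> norm_dir y l by exact: cvg_norm_dir.
have Nl : N @ U --> a by apply: cvg_enorm; exact: vcvg_line ul.
have lhs : (fun i => enorm (u i) ^+ 2 - d i ^+ 2) @ U -->
    enorm l ^+ 2 - norm_dir y l ^+ 2.
  by apply: cvgB; apply: cvgM => //; exact: cvg_enorm.
have rhs : (fun i => b i * (N i + (a + t i * d i))) @ U --> (0 : R).
  apply: (cvg_mul0l b0); apply: (cvgD Nl); apply: cvgD; first exact: cvg_cst.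
  by apply: (cvg_mul0l t0 dl).
apply: (ler_cvg_to lhs rhs); apply: nearW => i.
have NE : N i ^+ 2 = a ^+ 2 + 2 * t i * (a * d i) + t i ^+ 2 * enorm (u i) ^+ 2.
  by rewrite /N sqr_enormDZ /d /norm_dir (negPf y0) mulVKf ?gt_eqF.
have Nd : `|a + t i * d i| <= N i.
  rewrite -(@ler_pXn2r _ 2) ?nnegrE ?enorm_ge0 // real_normK ?num_real // NE.
  have : d i ^+ 2 <= enorm (u i) ^+ 2.
    by rewrite -subr_ge0 -sqr_enorm_orth_part sqr_ge0.
  have := sqr_ge0 (t i); nra.
have := ub i; rewrite -/(N i) -/(d i) => h.
have S0 : 0 <= N i + (a + t i * d i).
  by move: Nd; rewrite ler_norml => /andP[]; lra.
have t2 : 0 < t i ^+ 2 by rewrite exprn_gt0.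
rewrite -(ler_pM2l t2).
have -> : t i ^+ 2 * (enorm (u i) ^+ 2 - d i ^+ 2) =
    N i ^+ 2 - (a + t i * d i) ^+ 2 by rewrite NE; ring.
rewrite subr_sqr mulrA; apply: ler_wpM2r => //; lra.
Qed.

(** The derivative of [y / enorm y] is the projection orthogonal to [y] divided
    by [enorm y]; here the direction [u i] varies with the step [t i]. *)
Lemma unit_vector_derivative :
  vcvg U (fun i => (t i)^-1 *:
            ((enorm (y + t i *: u i))^-1 *: (y + t i *: u i) - a^-1 *: y))
         (a^-1 *: orth_part l).
Proof.
pose N i := enorm (y + t i *: u i).
have Nl : N @ U --> a by apply: cvg_enorm; exact: vcvg_line ul.
have Npos : \forall i \near U, 0 < N i by exact: cvgr_gt Nl _ a0.
have VN : (fun i => (N i)^-1) @ U --> a^-1 by apply: cvgV; rewrite ?gt_eqF.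
pose q i := (2 * dotv y (u i) + t i * enorm (u i) ^+ 2) *
  ((N i + a)^-1 * (a^-1 * (N i)^-1)).
have ql : q @ U --> a^-1 * (norm_dir y l / a).
  have -> : a^-1 * (norm_dir y l / a) =
      (2 * dotv y l + 0) * ((a + a)^-1 * (a^-1 * a^-1)).
    rewrite /norm_dir (negPf y0) -/a; field.
    by rewrite !gt_eqF ?addr_gt0.
  apply: cvgM.
    apply: cvgD.
      apply: cvgM; first exact: cvg_cst.
      by apply: cvg_dotv ul; exact: vcvg_cst.
    apply: (cvg_mul0l t0 (l := enorm l ^+ 2)).
    by apply: cvgM; exact: cvg_enorm.
  apply: cvgM; last by apply: cvgM => //; exact: cvg_cst.
  apply: cvgV; first by rewrite gt_eqF ?addr_gt0.
  by apply: cvgD => //; exact: cvg_cst.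
have lim : vcvg U (fun i => (N i)^-1 *: u i - q i *: y) (a^-1 *: orth_part l).
  rewrite /orth_part scalerBr scalerA.
  by apply: vcvgB; apply: vcvgZ => //; exact: vcvg_cst.
apply: vcvg_near lim; apply: filterS Npos => i Ni.
have NE : N i ^+ 2 =
    a ^+ 2 + 2 * t i * dotv y (u i) + t i ^+ 2 * enorm (u i) ^+ 2.
  exact: sqr_enormDZ.
have ti := tpos i.
have qE : q i = (t i)^-1 * (a^-1 - (N i)^-1).
  have -> : q i = (t i)^-1 * (N i ^+ 2 - a ^+ 2) *
      ((N i + a)^-1 * (a^-1 * (N i)^-1)).
    by rewrite NE /q; field; rewrite !gt_eqF // addr_gt0.
  by field; rewrite !gt_eqF // addr_gt0.
rewrite qE -/(N i); apply/matrixP => r s; rewrite !mxE.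
by field; rewrite !gt_eqF.
Qed.

End ActiveBlock.

(** A subgradient at a nonzero point is the normalised point, so approaching 0
    from the direction [l] makes it converge to the normalised [l]. *)
Lemma subgrad_inactive_limit k (t : nat -> R) (u z : nat -> 'cV[R]_k) l :
  l != 0 -> (forall i, 0 < t i) -> vcvg U u l ->
  (forall i, norm_subgrad (t i *: u i) (z i)) ->
  vcvg U z ((enorm l)^-1 *: l) /\ \forall i \near U, enorm (z i) = 1.
Proof.
move=> l0 tpos ul uz.
have unz : \forall i \near U, 0 < enorm (u i).
  by apply: cvgr_gt (cvg_enorm ul) _ _; rewrite enorm_gt0.
have zE : \forall i \near U, (enorm (u i))^-1 *: u i = z i.
  apply: filterS unz => i; rewrite enorm_gt0 => ui.
  have tu : t i *: u i != 0 by rewrite scaler_eq0 negb_or ui gt_eqF.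
  rewrite (norm_subgrad_active tu (uz i)) enormZ gtr0_norm // scalerA.
  by rewrite invfM mulrAC mulVf ?mul1r // gt_eqF.
split.
  apply: vcvg_near zE _; apply: vcvgZ => //.
  by apply: cvgV; [rewrite enorm_eq0|exact: cvg_enorm].
apply: filterS2 unz zE => i; rewrite enorm_gt0 => ui <-.
exact: enorm_normalized.
Qed.

End NormLimits.

(** * Minimizers, certificates and stable recovery *)

Section Recovery.
Variables (R : realType) (m n p : nat) (P : {set {set 'I_p}}).
Hypothesis partP : finset.partition P [set: 'I_p]%SET.
Variables (D : 'M[R]_(n, p)) (Phi : 'M[R]_(m, n)).
Variables (y0 : 'cV[R]_m) (x0 : 'cV[R]_n) (v : 'cV[R]_p) (eta : 'cV[R]_m).
Hypothesis feas0 : Phi *m x0 = y0.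
Hypothesis subv : group_subgrad P (D^T *m x0) v.
Hypothesis certv : D *m v = Phi^T *m eta.

Local Notation ybar := (D^T *m x0).
Local Notation f x := (norm12 P (D^T *m x)).
Local Notation dir0 w := (group_dir P ybar (D^T *m w)).

Lemma mem_active J : J \in P -> (J \in active P D x0) = (blk ybar J != 0).
Proof. by move=> JP; rewrite inE JP. Qed.

Lemma mem_inactive J : J \in P -> (J \in inactive P D x0) = (blk ybar J == 0).
Proof. by move=> JP; rewrite !inE JP andbT negbK. Qed.

Lemma active_sub J : J \in active P D x0 -> J \in P.
Proof. by rewrite inE => /andP[]. Qed.

Lemma inactive_sub J : J \in inactive P D x0 -> J \in P.
Proof. by rewrite inE => /andP[]. Qed.

Lemma blk_evec J : J \in active P D x0 ->
  blk (evec P D x0) J = (enorm (blk ybar J))^-1 *: blk ybar J.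
Proof.
move=> Jact; apply/matrixP => k j; rewrite ord1 !mxE.
rewrite (pblock_enum partP) ?active_sub //=.
by rewrite Jact mulrC.
Qed.

Lemma WsetE w : Wset P D Phi x0 w <-> Phi *m w = 0 /\ dir0 w = 0.
Proof.
rewrite /Wset /=; set s := (X in _ = 0 /\ X = 0).
suff -> : s = dir0 w by [].
rewrite /group_dir (bigID [pred J | J \in active P D x0]) /=; congr (_ + _).
  apply: eq_big => [J|J Jact]; first by rewrite andb_idl // => /active_sub.
  rewrite blk_adj blk_evec // /norm_dir dotvZl.
  by move: (Jact); rewrite mem_active ?active_sub // => /negPf ->.
apply: eq_big => [J|J Jin]; first by rewrite inE andbC.
move: (Jin); rewrite mem_inactive ?inactive_sub // => yJ.
by rewrite blk_adj /norm_dir yJ.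
Qed.

(** The certificate turns pairings with [D^T w] into pairings with [Phi w],
    which vanish on feasible directions. *)
Lemma cert_pairing w : dotv v (D^T *m w) = dotv eta (Phi *m w).
Proof. by rewrite -[D in LHS]trmxK -dotv_adj trmxK certv dotv_adj trmxK. Qed.

Lemma dir0_ge0 w : Phi *m w = 0 -> 0 <= dir0 w.
Proof.
move=> w0; apply: le_trans (group_subgrad_dir partP _ subv).
by rewrite cert_pairing w0 dotv0r.
Qed.

Lemma cert_lower x : f x0 + dotv eta (Phi *m x - y0) <= f x.
Proof.
rewrite -feas0 -mulmxBr -cert_pairing.
apply: le_trans (group_subgrad_le partP _ subv) _.
by rewrite -mulmxDr addrC subrK.
Qed.

Lemma cert_minimizer : minimizer P D Phi y0 x0.
Proof.
split=> // x xy0; have := cert_lower x.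
by rewrite xy0 subrr dotv0r addr0.
Qed.

(** The certificate bounds the directional derivative from below block by block;
    along [W] both totals are 0, so no block can be strict. *)
Lemma Wset_blockwise w J : Wset P D Phi x0 w -> J \in P ->
  dotv (blk v J) (blk (D^T *m w) J) =
  norm_dir (blk ybar J) (blk (D^T *m w) J).
Proof.
move=> /WsetE[w0 dirw] JP.
have gap L : L \in P ->
    0 <= norm_dir (blk ybar L) (blk (D^T *m w) L) -
         dotv (blk v L) (blk (D^T *m w) L).
  by move=> LP; rewrite subr_ge0; exact/norm_subgrad_dir/subv.
apply/esym/eqP; rewrite -subr_eq0; apply/eqP.
apply: (psumr_eq0P gap) => //.
rewrite sumrB -(dotv_blocks partP) -/(dir0 w) dirw cert_pairing w0.
by rewrite dotv0r subr0.
Qed.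

(** Along [w] in [E] the norm of each active block is affine as long as
    the block does not change sign, and that of an inactive block is linear in
    [t >= 0]; the total slope is 0 because [w] is in [W]. *)
Lemma norm12_line_const w : Wset P D Phi x0 w -> Eset P D x0 w ->
  exists2 t : R, 0 < t & f (x0 + t *: w) = f x0.
Proof.
move=> /WsetE[w0 dirw] Ew.
pose c J := norm_dir (blk ybar J) (blk (D^T *m w) J) / enorm (blk ybar J).
have s0 : 0 <= \sum_(J in P) `|c J| by apply: sumr_ge0.
exists (1 + \sum_(J in P) `|c J|)^-1 => [|]; first by rewrite invr_gt0 ltr_pwDl.
set t := _^-1; have t0 : 0 < t by rewrite invr_gt0 ltr_pwDl.
rewrite mulmxDr -scalemxAr.
suff -> : norm12 P (ybar + t *: (D^T *m w)) = f x0 + t * dir0 w.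
  by rewrite dirw mulr0 addr0.
rewrite mulr_sumr -big_split /=; apply: eq_bigr => J JP; rewrite blkD blkZ.
have tc : `|t * c J| <= 1.
  rewrite normrM gtr0_norm // /t mulrC ler_pdivrMr ?ltr_pwDl // mul1r.
  rewrite (bigD1 J) //= addrCA lerDl addr_ge0 //.
  by apply: sumr_ge0.
have [yJ0|yJ0] := eqVneq (blk ybar J) 0.
  by rewrite yJ0 add0r enormZ gtr0_norm // enorm0 add0r /norm_dir eqxx.
have [b wb] : exists b, blk (D^T *m w) J = b *: blk ybar J.
  by have [|b] := Ew J; [rewrite mem_active|rewrite blk_adj; exists b].
have y1 : enorm (blk ybar J) != 0 by rewrite enorm_eq0.
have dirb : norm_dir (blk ybar J) (blk (D^T *m w) J) = b * enorm (blk ybar J).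
  rewrite /norm_dir (negPf yJ0) wb dotvZr -sqr_enorm expr2.
  by rewrite mulrCA mulKf.
move: tc; rewrite /c dirb mulfK // ler_norml => /andP[tb _].
rewrite wb scalerA -{1}[blk ybar J]scale1r -scalerDl enormZ.
by rewrite ger0_norm ?mulrDl ?mul1r ?mulrA //; lra.
Qed.

Lemma unique_trivial_WE w : unique_minimizer P D Phi y0 x0 ->
  Wset P D Phi x0 w -> Eset P D x0 w -> w = 0.
Proof.
move=> [_ uniq] Ww Ew; have [t t0 ft] := norm12_line_const Ww Ew.
have xt : x0 + t *: w = x0.
  apply: uniq; split.
    by case: Ww => w0 _; rewrite mulmxDr -scalemxAr w0 scaler0 addr0.
  by move=> x xy0; rewrite ft; case: cert_minimizer => _; exact.
have : t *: w = 0 by apply: (addrI x0); rewrite addr0.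
by move/eqP; rewrite scaler_eq0 gt_eqF //= => /eqP.
Qed.

(** On the segment to another minimizer [f] is constant by convexity, against
    quadratic growth near [x0]. *)
Lemma strong_unique :
  strong_minimizer P D Phi y0 x0 -> unique_minimizer P D Phi y0 x0.
Proof.
move=> [_ [kappa [eps [k0 e0 growth]]]]; split; first exact: cert_minimizer.
move=> x [xy0 xmin]; apply/eqP; rewrite -subr_eq0.
apply/negPn/negP => d0; set d := x - x0 in d0.
have dn : 0 < enorm d by rewrite enorm_gt0.
pose t := Num.min 1 (eps / enorm d).
have t0 : 0 < t by rewrite lt_min ltr01 divr_gt0.
have t1 : t <= 1 by rewrite ge_min lexx.
have te : t * enorm d <= eps by rewrite -ler_pdivlMr // ge_min lexx orbT.
have fx : f x <= f x0 by apply: xmin.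
have := growth (x0 + t *: d).
rewrite addrAC subrr add0r enormZ (gtr0_norm t0) => /(_ _ te) grow.
have {grow} : kappa / 2 * (t * enorm d) ^+ 2 <= f (x0 + t *: d) - f x0.
  apply: grow; rewrite mulmxDr -scalemxAr mulmxBr xy0 feas0 subrr.
  by rewrite scaler0 addr0.
have := @norm12_convex _ _ P ybar (D^T *m d) t.
rewrite (ltW t0) t1 => /(_ isT).
rewrite scalemxAr -!mulmxDr /d (addrC x0 (x - x0)) subrK -/d => conv.
have : 0 < kappa / 2 * (t * enorm d) ^+ 2.
  by rewrite mulr_gt0 ?divr_gt0 // exprn_gt0 // mulr_gt0.
nra.
Qed.

(** With data [y0 + mu eta] the objective of the regularised problem is, up to a
    constant, at least [enorm (Phi x - y0) ^+ 2 / 2 + mu f x0], with equality at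
    every minimizer [x] of the constrained problem; so [x] is at distance
    [O(mu)] of [x0] for all small [mu]. *)
Lemma stable_unique :
  stable_recovery P D Phi y0 x0 -> unique_minimizer P D Phi y0 x0.
Proof.
move=> stab; split; first exact: cert_minimizer.
(* This constant keeps the shift [mu eta] below the noise level [mu / c]. *)
move=> x [xy0 xmin]; set c : R := (1 + enorm eta)^-1.
have e0 := enorm_ge0 eta.
have c0 : 0 < c by rewrite invr_gt0 ltr_pwDl.
have [K [dbar [K0 dbar0 stable]]] := stab _ c0.
apply/eqP; rewrite -subr_eq0 -enorm_eq0 eq_le enorm_ge0 andbT.
apply: (@le0_of_linear_bound _ _ (K * dbar / 2)) => [|t /andP[t0 t1]].
  by rewrite !mulr_ge0 ?invr_ge0 // ltW.
pose delta := dbar / 2 * t.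
have d0 : 0 < delta by rewrite !mulr_gt0 // invr_gt0.
have -> : K * dbar / 2 * t = K * delta by rewrite /delta; ring.
have cd : 0 < c * delta by rewrite mulr_gt0.
pose y := y0 + (c * delta) *: eta.
have ydist : enorm (y - y0) <= delta.
  rewrite addrAC subrr add0r enormZ (gtr0_norm cd) mulrAC.
  by rewrite ger_pMl // /c mulrC ler_pdivrMr ?ltr_pwDl // mul1r lerDr.
apply: (stable delta y x _ ydist) => [|x'].
  rewrite d0 /= /delta; nra.
rewrite /reg_objective /y !opprD !addrA xy0 subrr add0r.
rewrite -scaleNr !sqr_enormDZ enormZ normrN (gtr0_norm cd).
have := cert_lower x'; have := xmin _ feas0.
set a := enorm eta; set r := Phi *m x' - y0; rewrite (dotvC eta).
move=> h1 h2.
have := ler_wpM2l (ltW cd) (le_trans _ h2); have := sqr_ge0 (enorm r); nra.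
Qed.

Local Notation harm i := (i.+1%:R^-1 : R).

Section AlongUltrafilter.
Context {U : set_system nat} {UU : UltraFilter U}.
Hypothesis ooU : \oo `<=` U.

Lemma harmonic_cvg0 (C : R) : (fun i => C * harm i) @ U --> (0 : R).
Proof.
rewrite -(mulr0 C); apply: cvgM; first exact: cvg_cst.
by apply: cvg_trans cvg_harmonic; exact: (cvg_app _ ooU).
Qed.

Lemma vcvg_of_blocks (x : nat -> 'cV[R]_p) :
  (forall J, J \in P -> exists l, vcvg U (fun i => blk (x i) J) l) ->
  exists l, vcvg U x l.
Proof.
move=> xJ; apply: vcvg_entries => i; have [l xl] := xJ _ (pblock_in partP i).
exists (l (enum_rank_in (pblock_self partP i) i) 0).
have := xl (enum_rank_in (pblock_self partP i) i).
under eq_fun do rewrite blkE enum_rankK_in ?pblock_self //; exact.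
Qed.

Lemma Wset_limit (w : nat -> 'cV[R]_n) l (b : nat -> R) :
  vcvg U w l -> Phi *m l = 0 -> b @ U --> (0 : R) ->
  (forall i, dir0 (w i) <= b i) -> Wset P D Phi x0 l.
Proof.
move=> wl l0 b0 wb; apply/WsetE; split=> //.
apply/eqP; rewrite eq_le dir0_ge0 // andbT.
have dirl : (fun i => dir0 (w i)) @ U --> dir0 l.
  exact/cvg_group_dir/vcvg_mulmx.
by apply: (ler_cvg_to dirl b0); exact: nearW.
Qed.

Lemma orth_part_Eset w :
  (forall J, J \in active P D x0 ->
    orth_part (blk ybar J) (blk (D^T *m w) J) = 0) -> Eset P D x0 w.
Proof.
move=> orth0 J Jact.
exists (norm_dir (blk ybar J) (blk (D^T *m w) J) / enorm (blk ybar J)).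
by rewrite blk_adj; apply/eqP; rewrite -subr_eq0; apply/eqP/orth0.
Qed.

Lemma unit_direction_limit (x : nat -> 'cV[R]_n) : (forall i, x i != x0) ->
  exists wi w, [/\ forall i, wi i = (enorm (x i - x0))^-1 *: (x i - x0),
    forall i, x i = x0 + enorm (x i - x0) *: wi i, enorm w = 1 & vcvg U wi w].
Proof.
move=> xx0; pose wi i := (enorm (x i - x0))^-1 *: (x i - x0).
have wi1 i : enorm (wi i) = 1 by rewrite enorm_normalized // subr_eq0.
have [|w wl] := @ultra_bounded_vcvg R U UU n wi 1.
  by apply: nearW => i; rewrite wi1.
exists wi, w; split=> // [i|].
  by rewrite scalerA mulfV ?scale1r ?enorm_eq0 ?subr_eq0 // addrC subrK.
have w1l : (fun=> 1 : R) @ U --> enorm w.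
  have -> : (fun=> 1 : R) = (fun i : nat => enorm (wi i)) by exact/esym/funext.
  exact: cvg_enorm.
exact: (cvg_unique _ w1l (cvg_cst _)).
Qed.

End AlongUltrafilter.

(** Steps that violate quadratic growth at the rate [1 / (i + 1)] have their
    normalised limit in [W], and each active block inherits the [o(t^2)] bound
    because the other blocks and the first-order term are nonnegative. *)
Lemma trivial_WE_strong :
  (forall w, Wset P D Phi x0 w -> Eset P D x0 w -> w = 0) ->
  strong_minimizer P D Phi y0 x0.
Proof.
move=> WE0; apply: contrapT => nstrong.
have /choice[x xP] i : exists x, [/\ Phi *m x = y0, enorm (x - x0) <= harm i &
    f x - f x0 < harm i / 2 * enorm (x - x0) ^+ 2].
  apply: contrapT => nx; apply: nstrong; split=> //.
  exists (harm i), (harm i); split; rewrite ?invr_gt0 // => x xy0 xi.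
  by rewrite leNgt; apply/negP => lt; apply: nx; exists x.
have [U UU ooU] := ex_ultra.
have xx0 i : x i != x0.
  apply/eqP => xi; have [_ _] := xP i.
  by rewrite xi !subrr enorm0 expr0n /= mulr0 ltxx.
have [wi [w [wiE xE w1 wl]]] := unit_direction_limit (U := U) xx0.
pose t i := enorm (x i - x0).
have tpos i : 0 < t i by rewrite enorm_gt0 subr_eq0.
have h0 C : (fun i => C * harm i) @ U --> (0 : R) by exact: harmonic_cvg0.
have t0 : t @ U --> (0 : R).
  apply: (squeeze_cvgr _ (cvg_cst (0 : R)) (h0 1)); apply: nearW => i /=.
  by rewrite mul1r enorm_ge0; case: (xP i).
have Phiwi i : Phi *m wi i = 0.
  rewrite wiE -scalemxAr mulmxBr feas0; case: (xP i) => -> _ _.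
  by rewrite subrr scaler0.
have Phiw : Phi *m w = 0.
  apply: (vcvg_unique (vcvg_mulmx Phi wl)).
  by apply: vcvg_near (vcvg_cst 0); apply: nearW => i; rewrite Phiwi.
have gap J i : J \in P -> enorm (blk ybar J + t i *: blk (D^T *m wi i) J)
    - enorm (blk ybar J) - t i * norm_dir (blk ybar J) (blk (D^T *m wi i) J)
    <= f (x i) - f x0 - t i * dir0 (wi i).
  move=> JP; rewrite {1}(xE i) mulmxDr -scalemxAr mulr_sumr -!sumrB.
  rewrite [leRHS](bigD1 J) //= blkD blkZ lerDl.
  apply: sumr_ge0 => L /andP[LP _].
  by rewrite blkD blkZ -addrA -opprD subr_ge0 norm_dir_le // ltW.
have grow i : f (x i) - f x0 <= (2^-1 * harm i) * t i ^+ 2.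
  by rewrite (mulrC 2^-1); case: (xP i) => _ _ /ltW.
have Ww : Wset P D Phi x0 w.
  apply: (Wset_limit wl Phiw (b := fun i => (2^-1 * harm i) * t i)).
    exact: cvg_mul0l (h0 _) t0.
  move=> i; rewrite -(ler_pM2l (tpos i)).
  have := group_dir_le P ybar (D^T *m wi i) (ltW (tpos i)).
  rewrite scalemxAr -mulmxDr -xE; have := grow i; rewrite expr2.
  move: (2^-1 / _) => q; nra.
have Ew : Eset P D x0 w.
  apply: orth_part_Eset => J Jact; have JP := active_sub Jact.
  apply: (@norm_flat_limit _ _ _ _ _ t (fun i => blk (D^T *m wi i) J) _
    _ tpos t0 _ (fun i => 2^-1 * harm i)) => //.
  - by rewrite -(mem_active JP).
  - exact/vcvg_blk/vcvg_mulmx.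
  move=> i; apply: le_trans (gap J i JP) _; apply: le_trans (grow i).
  rewrite gerBl; apply: mulr_ge0; first exact: ltW.
  exact: dir0_ge0.
have := WE0 w Ww Ew => w0; move/eqP: w1; rewrite w0 enorm0 eq_sym oner_eq0.
by [].
Qed.

(** Stated at a fixed [w], because nondegeneracy is applied at the one direction
    from which solutions violating stability approach [x0]. *)
Definition nondegenerate_at (w : 'cV[R]_n) : Prop :=
  forall z : tup R (Kset P D x0 v),
    im_sum Phi D (Hset P D x0 v) (Dtup D z) ->
    (forall J, val J \in Kdir P D x0 w -> dotv (z J) (blk v (val J)) = 0) ->
    (forall J, val J \notin Kdir P D x0 w ->
       0 <= dotv (z J) (blk v (val J))) ->
    forall J, z J = 0.

Local Notation I := (active P D x0).
Local Notation K := (Kset P D x0 v).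
Local Notation H := (Hset P D x0 v).

Lemma Kset_sub : {subset K <= P}.
Proof. by move=> J; rewrite inE => /andP[/inactive_sub]. Qed.

Lemma Hset_sub : {subset H <= P}.
Proof. by move=> J; rewrite inE => /andP[/inactive_sub]. Qed.

Lemma block_cases J : J \in P ->
  [\/ [/\ J \in I, J \notin K & J \notin H],
      [/\ J \notin I, J \in K & J \notin H] |
      [/\ J \notin I, J \notin K & J \in H]].
Proof.
move=> JP; rewrite !inE JP /= andbT negbK.
have [v1 _] := subv JP; case: eqVneq => yJ /=; last by constructor 1.
case: (ltgtP (enorm (blk v J)) 1) v1 => // _ _; last by constructor 2.
by constructor 3.
Qed.

(** On a block where the certificate is strictly inside the unit ball, it
    cannot reach the norm of a nonzero vector. *)
Lemma Wset_H w J : Wset P D Phi x0 w -> J \in H -> blk (D^T *m w) J = 0.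
Proof.
move=> Ww JH; have JP := Hset_sub JH.
move: JH; rewrite inE => /andP[]; rewrite (mem_inactive JP) => yJ vJ.
have := Wset_blockwise Ww JP; rewrite /norm_dir yJ => vw.
apply/eqP; rewrite -enorm_eq0; apply/negPn/negP => w0.
have wpos : 0 < enorm (blk (D^T *m w) J) by rewrite lt0r w0 enorm_ge0.
have := cauchy_schwarz (blk v J) (blk (D^T *m w) J).
by rewrite vw leNgt => /negP; apply; rewrite gtr_pMl.
Qed.

Lemma Wset_K w J : Wset P D Phi x0 w -> J \in K ->
  blk (D^T *m w) J = enorm (blk (D^T *m w) J) *: blk v J.
Proof.
move=> Ww JK; have JP := Kset_sub JK.
move: JK; rewrite inE => /andP[]; rewrite (mem_inactive JP) => yJ /eqP vJ.
have := Wset_blockwise Ww JP; rewrite /norm_dir yJ => vw.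
have [->|w0] := eqVneq (blk (D^T *m w) J) 0; first by rewrite enorm0 scale0r.
rewrite (dual_vector_unique w0 _ vw) ?vJ // scalerA mulfV ?scale1r //.
by rewrite enorm_eq0.
Qed.

Lemma range_limit (U : set_system nat) {UU : UltraFilter U}
    (g : nat -> 'cV[R]_p) l :
  (forall i, exists a b, D *m g i = Phi^T *m a + D *m (mask R P H *m b)) ->
  vcvg U g l -> exists a b, D *m l = Phi^T *m a + D *m (mask R P H *m b).
Proof.
move=> gE gl.
have [|a aE] := @vcvg_range R U UU n (m + p) (row_mx Phi^T (D *m mask R P H))
    (fun i => D *m g i) (D *m l) _ (vcvg_mulmx D gl).
  by move=> i; have [a [b ->]] := gE i; exists (col_mx a b);
    rewrite mul_row_col mulmxA.
exists (usubmx a), (dsubmx a).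
by rewrite aE -[a in LHS]vsubmxK mul_row_col mulmxA.
Qed.

(** The key step. The differences [r] of the subgradients [z] and the
    certificate [v] satisfy [D r] in the range of [Phi^T]. Restricted to the
    active blocks and those of [K], they are normalised by [rho], the sum of
    their size [s] on [K] and of the step [t], the latter being their order of
    magnitude on the active blocks. Hence they have a limit [l], which cannot
    vanish together with the limit [al] of [t / rho]. On an active block, [l] is
    [al] times the derivative of the normalised vector along [w]. On a block of
    [K] it satisfies the (opposite) sign conditions of the nondegeneracy
    hypothesis. Its pairing with [D^T w] is 0 and is also [al] times the
    curvature of [f] along [w]. If [al] is nonzero, the curvature vanishes and
    [w] is in [E]; if [al = 0], nondegeneracy applied to [- l] gives [l = 0]. *)
Lemma nondegenerate_Eset (U : set_system nat) {UU : UltraFilter U}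
    (t : nat -> R) (wi : nat -> 'cV[R]_n) w (z : nat -> 'cV[R]_p)
    (b : nat -> 'cV[R]_m) :
  (forall i, 0 < t i) -> t @ U --> (0 : R) -> vcvg U wi w ->
  (forall i, group_subgrad P (D^T *m (x0 + t i *: wi i)) (z i)) ->
  (forall i, D *m z i = Phi^T *m b i) ->
  Wset P D Phi x0 w -> nondegenerate_at w -> Eset P D x0 w.
Proof.
move=> tpos t0 wl zsub zb Ww nondeg.
have xJ i J : blk (D^T *m (x0 + t i *: wi i)) J =
    blk ybar J + t i *: blk (D^T *m wi i) J.
  by rewrite mulmxDr -scalemxAr blkD blkZ.
have uJ J : vcvg U (fun i => blk (D^T *m wi i) J) (blk (D^T *m w) J).
  exact/vcvg_blk/vcvg_mulmx.
pose r i := z i - v.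
pose s i := \sum_(J in K) enorm (blk (r i) J).
have s0 i : 0 <= s i by apply: sumr_ge0 => J _; exact: enorm_ge0.
pose rho i := s i + t i.
have rpos i : 0 < rho i by rewrite ltr_wpDl.
pose alpha i := (rho i)^-1 * t i.
pose M := mask R P (I :|: K).
pose g i := (rho i)^-1 *: (M *m r i).
have gJ i J : J \in P -> blk (g i) J =
    if J \in I :|: K then (rho i)^-1 *: blk (r i) J else 0.
  by move=> JP; rewrite blkZ (blk_mask partP) //; case: ifP; rewrite ?scaler0.
have [al al_lim] : exists a : R, alpha @ U --> a.
  apply: (@ultra_bounded_cvg _ _ _ _ 1); apply: nearW => i.
  rewrite ger0_norm; last by rewrite ltW // mulr_gt0 ?invr_gt0.
  by rewrite /alpha mulrC ler_pdivrMr // mul1r /rho lerDr.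
have gI J : J \in I -> vcvg U (fun i => blk (g i) J)
    (al *: ((enorm (blk ybar J))^-1 *:
              orth_part (blk ybar J) (blk (D^T *m w) J))).
  move=> JI; have JP := active_sub JI.
  have y1 : blk ybar J != 0 by rewrite -(mem_active JP).
  apply: (vcvg_near _
    (vcvgZ al_lim (unit_vector_derivative y1 tpos t0 (uJ J)))).
  have Npos : \forall i \near U,
      0 < enorm (blk ybar J + t i *: blk (D^T *m wi i) J).
    apply: cvgr_gt (cvg_enorm (vcvg_line t0 (uJ J))) _ _.
    by rewrite enorm_gt0.
  apply: filterS Npos => i; rewrite enorm_gt0 => xi0.
  rewrite gJ // inE JI /= blkD blkN (norm_subgrad_active y1 (subv JP)).
  have := zsub i J JP; rewrite xJ => /(norm_subgrad_active xi0) ->.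
  by rewrite /alpha scalerA mulfK ?gt_eqF.
have gK J : J \in K -> exists l, vcvg U (fun i => blk (g i) J) l.
  move=> JK; apply: (@ultra_bounded_vcvg _ _ _ _ _ 1); apply: nearW => i.
  rewrite gJ ?Kset_sub // inE JK orbT enormZ gtr0_norm ?invr_gt0 //.
  rewrite mulrC ler_pdivrMr // mul1r /rho /s (bigD1 J) //= -addrA lerDl.
  rewrite addr_ge0 ?(ltW (tpos i)) //.
  by apply: sumr_ge0 => L _; exact: enorm_ge0.
have gH i J : J \in H -> blk (g i) J = 0.
  move=> JH; have JP := Hset_sub JH; rewrite gJ //.
  by case: (block_cases JP) => -[/negPf a1 /negPf a2 a3] //;
     rewrite ?JH // in a3 *; rewrite inE a1 a2.
have [l gl] : exists l, vcvg U g l.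
  apply: vcvg_of_blocks => J JP; case: (block_cases JP) => -[JI JK JH].
  - by eexists; exact: gI.
  - exact: gK.
  by exists 0; apply: vcvg_near (vcvg_cst 0); apply: nearW => i; rewrite gH.
have lJ J := vcvg_blk J gl.
have lI J : J \in I -> blk l J = al *: ((enorm (blk ybar J))^-1 *:
              orth_part (blk ybar J) (blk (D^T *m w) J)).
  by move=> JI; exact: vcvg_unique (lJ J) (gI J JI).
have lH J : J \in H -> blk l J = 0.
  move=> JH; apply: (vcvg_unique (lJ J)).
  by apply: vcvg_near (vcvg_cst 0); apply: nearW => i; rewrite gH.
have [a [c Dl]] : exists a c, D *m l = Phi^T *m a + D *m (mask R P H *m c).
  apply: range_limit gl => i.
  exists ((rho i)^-1 *: (b i - eta)), (- (rho i)^-1 *: r i).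
  have Dr : D *m r i = Phi^T *m (b i - eta) by rewrite !mulmxBr zb certv.
  have -> : g i = (rho i)^-1 *: (r i - mask R P H *m r i).
    congr (_ *: _); apply: (blk_inj partP) => J JP.
    rewrite blkD blkN !(blk_mask partP) // inE.
    by case: (block_cases JP) => -[JI JK JH];
      rewrite ?JI ?JK ?JH ?(negPf JI) ?(negPf JK) ?(negPf JH) ?orbT /=
        ?subr0 ?subrr.
  by rewrite scaleNr !mulmxN -!scalemxAr mulmxBr Dr scalerBr.
(* [w] is in the kernel of [Phi], and [D^T w] vanishes on the blocks of [H]. *)
have pairing : dotv l (D^T *m w) = 0.
  have -> : dotv l (D^T *m w) = dotv (D *m l) w by rewrite dotv_adj.
  rewrite Dl dotvDl !dotv_adj trmxK.
  have [Phiw _] := (WsetE w).1 Ww.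
  rewrite Phiw dotv0r add0r -dotv_adj (dotv_blocks partP) big1 // => J JP.
  rewrite (blk_mask partP) //; case: ifP => JH; last by rewrite dotv0l.
  by rewrite Wset_H ?dotv0r.
have lKdir J : J \in K -> blk (D^T *m w) J != 0 -> dotv (blk l J) (blk v J) = 0.
  move=> JK wJ; have JP := Kset_sub JK.
  move: (JK); rewrite inE => /andP[]; rewrite (mem_inactive JP).
  move=> /eqP yJ /eqP vJ.
  have zs i : norm_subgrad (t i *: blk (D^T *m wi i) J) (blk (z i) J).
    by have := zsub i J JP; rewrite xJ yJ add0r.
  have [zl z1] := subgrad_inactive_limit wJ tpos (uJ J) zs.
  have vE : (enorm (blk (D^T *m w) J))^-1 *: blk (D^T *m w) J = blk v J.
    by rewrite [X in _ *: X](Wset_K Ww JK) scalerA mulVf ?scale1r ?enorm_eq0.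
  rewrite vE in zl.
  have rl : vcvg U (fun i => blk (r i) J) 0.
    rewrite -(subrr (blk v J)).
    apply: vcvg_near (vcvgB zl (vcvg_cst (blk v J))).
    by apply: nearW => i; rewrite blkD blkN.
  (* For unit vectors [z] and [v], [2 <z - v, v> = - |z - v|^2]: the normalised
     difference pairs with [v] like a term of higher order. *)
  have lim0 : (fun i => - 2^-1 * dotv (blk (g i) J) (blk (r i) J)) @ U -->
      (0 : R).
    rewrite -[X in _ --> X](mulr0 (- 2^-1)) -(dotv0r (blk l J)).
    by apply: cvgM; [exact: cvg_cst|exact: cvg_dotv].
  have lim1 : (fun i => dotv (blk (g i) J) (blk v J)) @ U -->
      dotv (blk l J) (blk v J).
    by apply: cvg_dotv; [exact: lJ|exact: vcvg_cst].
  suff lim2 : (fun i => dotv (blk (g i) J) (blk v J)) @ U --> (0 : R).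
    exact: (cvg_unique _ lim1 lim2).
  apply: cvg_trans lim0; apply: near_eq_cvg.
  apply: filterS z1 => i zi1; rewrite gJ // inE JK orbT !dotvZl mulrCA.
  congr (_ * _); rewrite blkD blkN !dotv_linE (dotvC (blk v J)) -!sqr_enorm.
  by rewrite zi1 vJ; lra.
have lKle J : J \in K -> dotv (blk l J) (blk v J) <= 0.
  move=> JK; have JP := Kset_sub JK.
  have lim1 : (fun i => dotv (blk (g i) J) (blk v J)) @ U -->
      dotv (blk l J) (blk v J).
    by apply: cvg_dotv; [exact: lJ|exact: vcvg_cst].
  apply: (ler_cvg_to lim1 (cvg_cst (0 : R))); apply: nearW => i.
  rewrite gJ // inE JK orbT dotvZl pmulr_rle0 ?invr_gt0 //.
  move: JK; rewrite inE => /andP[_ /eqP vJ].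
  rewrite blkD blkN dotvDl dotvNl -sqr_enorm vJ expr1n subr_le0.
  apply: le_trans (cauchy_schwarz _ _) _; rewrite vJ mulr1.
  by case: (zsub i J JP).
have al0 : 0 <= al.
  apply: (ler_cvg_to (cvg_cst (0 : R)) al_lim); apply: nearW => i.
  by rewrite ltW // mulr_gt0 ?invr_gt0.
have alE J : J \in I ->
    al * enorm (orth_part (blk ybar J) (blk (D^T *m w) J)) ^+ 2 = 0.
  move=> JI; have JP := active_sub JI.
  have term L : L \in I -> dotv (blk l L) (blk (D^T *m w) L) =
     (enorm (blk ybar L))^-1 *
     (al * enorm (orth_part (blk ybar L) (blk (D^T *m w) L)) ^+ 2).
    move=> LI; have LP := active_sub LI.
    have y1 : blk ybar L != 0 by rewrite -(mem_active LP).
    by rewrite lI // !dotvZl dotv_orth_part // -sqr_enorm_orth_part // mulrCA.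
  have ge0 L : L \in P -> 0 <= dotv (blk l L) (blk (D^T *m w) L).
    move=> LP; case: (block_cases LP) => -[LI LK LH].
    - rewrite term //; apply: mulr_ge0; first by rewrite invr_ge0 enorm_ge0.
      by rewrite mulr_ge0 ?sqr_ge0.
    - rewrite (Wset_K Ww LK) dotvZr.
      have [->|wL] := eqVneq (blk (D^T *m w) L) 0; first by rewrite enorm0 mul0r.
      by rewrite lKdir // mulr0.
    by rewrite lH // dotv0l.
  have sum0 : \sum_(L in P) dotv (blk l L) (blk (D^T *m w) L) = 0.
    by rewrite -(dotv_blocks partP).
  have /eqP := psumr_eq0P ge0 sum0 JP.
  rewrite term // mulf_eq0 invr_eq0 enorm_eq0.
  by move: JI; rewrite (mem_active JP) => /negPf -> /eqP.
have [al00|alN0] := eqVneq al 0; last first.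
  apply: orth_part_Eset => J /alE /eqP; rewrite mulf_eq0 (negPf alN0) /=.
  by rewrite sqrf_eq0 enorm_eq0 => /eqP.
exfalso.
have lK0 J : J \in K -> blk l J = 0.
  move=> JK; apply/oppr_inj; rewrite oppr0 -blkN.
  pose zl := fun L : {L | L \in K} => blk (- l) (val L).
  suff zl0 : forall L, zl L = 0 by exact: (zl0 (exist _ J JK)).
  have Dzl : Dtup D zl = - (D *m l).
    rewrite (Dtup_mask partP D _ Kset_sub) -mulmxN; congr (_ *m _).
    apply: (blk_inj partP) => L LP; rewrite (blk_mask partP) // blkN.
    case: (block_cases LP) => -[LI LK LH]; rewrite ?LK ?(negPf LK) //.
      by rewrite lI // al00 scale0r oppr0.
    by rewrite lH // oppr0.
  apply: nondeg => [|L|L].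
  - exists (- a), (fun L : {L | L \in H} => blk (- c) (val L)).
    by rewrite Dzl (Dtup_mask partP D _ Hset_sub) Dl !mulmxN opprD.
  - rewrite inE => /andP[_]; rewrite blk_adj => wL.
    by rewrite /zl blkN dotvNl lKdir ?oppr0 //; exact: valP.
  - by move=> _; rewrite /zl blkN dotvNl oppr_ge0 lKle //; exact: valP.
have lim1 : (fun i => \sum_(J in K) enorm (blk (g i) J) + alpha i) @ U -->
    \sum_(J in K) enorm (blk l J) + al.
  by apply: cvgD => //; apply: ultra_cvg_sum => J _; apply: cvg_enorm; exact: lJ.
(* The choice of [rho] makes this sum equal to 1 all along. *)
have one : (fun i => \sum_(J in K) enorm (blk (g i) J) + alpha i) = fun=> 1.
  apply/funext => i.
  rewrite (eq_bigr (fun J => (rho i)^-1 * enorm (blk (r i) J))) => [|J JK].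
    by rewrite -mulr_sumr -mulrDr mulVf ?gt_eqF.
  by rewrite gJ ?Kset_sub // inE JK orbT enormZ gtr0_norm ?invr_gt0.
rewrite one al00 addr0 big1 in lim1; last by move=> J JK; rewrite lK0 ?enorm0.
have zero1 : 0 = 1 :> R by exact: (cvg_unique _ lim1 (cvg_cst _)).
by move/eqP: zero1; rewrite eq_sym oner_eq0.
Qed.

(** Compare the objective at [x] with its value at [x0]; the certificate bounds
    the possible decrease of [f] by [enorm eta * enorm (Phi x - y0)]. *)
Lemma reg_solution_bounds (c delta : R) y x : 0 < c -> 0 < delta ->
  enorm (y - y0) <= delta -> reg_solution P D Phi y (c * delta) x ->
  enorm (Phi *m x - y0) <= 2 * (1 + c * enorm eta) * delta /\
  f x - f x0 <= (2 * c)^-1 * delta.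
Proof.
move=> c0 d0 ey sol; have cd : 0 < c * delta by rewrite mulr_gt0.
have := sol x0; rewrite /reg_objective feas0 -(opprB y y0) enormN.
have -> : Phi *m x - y = (Phi *m x - y0) + (-1) *: (y - y0).
  by rewrite scaleN1r opprB addrA subrK.
rewrite sqr_enormDZ sqrrN expr1n mul1r.
have := cert_lower x.
have hb := enorm_ge0 (Phi *m x - y0); have eb := enorm_ge0 (y - y0).
have etab := enorm_ge0 eta.
have cs1 := cauchy_schwarz (Phi *m x - y0) (y - y0).
have cs2 := cauchy_schwarz (- eta) (Phi *m x - y0).
move: cs2; rewrite enormN dotvNl.
move: hb cs1; set h := enorm (Phi *m x - y0); set b := enorm (y - y0) in eb ey *.
set e := enorm eta in etab *; set q := dotv _ (y - y0); set pr := dotv eta _.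
set F := f x; set F0 := f x0.
move=> hb cs1 cs2 low opt.
have cl := ler_wpM2l (ltW cd) low; have cs2' := ler_wpM2l (ltW cd) cs2.
have hd : h * b <= h * delta by rewrite ler_wpM2l.
split.
  rewrite leNgt; apply/negP => lt.
  have hpos : 0 < h.
    apply: le_lt_trans lt; rewrite mulr_ge0 ?(ltW d0) //.
    by rewrite mulr_ge0 // addr_ge0 // mulr_ge0 // ltW.
  have hh : h * h <= h * (2 * (1 + c * e) * delta) by nra.
  by move: hh; rewrite ler_pM2l // leNgt lt.
have gapF : c * delta * (F - F0) <= 2^-1 * b ^+ 2.
  have := sqr_ge0 (h - b); nra.
have b2 : b ^+ 2 <= delta ^+ 2 by rewrite ler_pXn2r ?nnegrE ?(ltW d0).
rewrite -(ler_pM2l cd); apply: le_trans gapF _.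
have -> : c * delta * ((2 * c)^-1 * delta) = 2^-1 * delta ^+ 2.
  by field; rewrite gt_eqF.
by rewrite ler_pM2l ?invr_gt0.
Qed.

(** A failure of stability yields solutions [x i] with
    [enorm (x i - x0) > (i + 1) delta i] at some noise level [delta i]. Whatever
    the size of [delta i], the bounds of [reg_solution_bounds] are then
    [o(enorm (x i - x0))]. *)
Lemma unique_nondegenerate_stable : unique_minimizer P D Phi y0 x0 ->
  (forall w, Wset P D Phi x0 w -> nondegenerate_at w) ->
  stable_recovery P D Phi y0 x0.
Proof.
move=> uniq nondeg c c0; apply: contrapT => nstable.
have /choice[S SP] i : exists S : R * 'cV[R]_m * 'cV[R]_n,
    [/\ 0 < S.1.1, enorm (S.1.2 - y0) <= S.1.1,
        reg_solution P D Phi S.1.2 (c * S.1.1) S.2 &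
        i.+1%:R * S.1.1 < enorm (S.2 - x0)].
  apply: contrapT => nS; apply: nstable.
  exists i.+1%:R, 1; split=> // delta y x /andP[d0 _] yd sol.
  by rewrite leNgt; apply/negP => lt; apply: nS; exists (delta, y, x).
pose del i := (S i).1.1; pose x i := (S i).2.
have del0 i : 0 < del i by case: (SP i).
have far i : i.+1%:R * del i < enorm (x i - x0) by case: (SP i).
pose t i := enorm (x i - x0).
have tpos i : 0 < t i by apply: lt_trans (far i); rewrite mulr_gt0.
have [U UU ooU] := ex_ultra.
have xx0 i : x i != x0 by rewrite -subr_eq0 -enorm_gt0 tpos.
have [wi [w [wiE xE w1 wl]]] := unit_direction_limit (U := U) xx0.
have h0 C : (fun i => C * harm i) @ U --> (0 : R) by exact: harmonic_cvg0.
have ratio i C : 0 <= C -> C * del i <= C * harm i * t i.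
  move=> C0; rewrite -mulrA ler_wpM2l // mulrC ler_pdivlMr // mulrC.
  exact: ltW.
set C1 := 2 * (1 + c * enorm eta); set C2 := (2 * c)^-1.
have C10 : 0 <= C1.
  by rewrite mulr_ge0 // addr_ge0 // mulr_ge0 ?enorm_ge0 // ltW.
have C20 : 0 <= C2 by rewrite invr_ge0 mulr_ge0 // ltW.
have bounds i : enorm (Phi *m x i - y0) <= C1 * harm i * t i /\
    f (x i) - f x0 <= C2 * harm i * t i.
  have [d0 yd sol _] := SP i; have [b1 b2] := reg_solution_bounds c0 d0 yd sol.
  by split; [apply: le_trans b1 _|apply: le_trans b2 _]; exact: ratio.
have Phiw : Phi *m w = 0.
  apply/eqP; rewrite -enorm_eq0 eq_le enorm_ge0 andbT.
  have lim : (fun i => enorm (Phi *m wi i)) @ U --> enorm (Phi *m w).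
    exact/cvg_enorm/vcvg_mulmx.
  apply: (ler_cvg_to lim (h0 C1)); apply: nearW => i.
  rewrite wiE -scalemxAr mulmxBr feas0 enormZ gtr0_norm ?invr_gt0 ?tpos //.
  by rewrite mulrC ler_pdivrMr ?tpos //; case: (bounds i).
have t0 : t @ U --> (0 : R).
  apply: contrapT => /(ultra_nle_cvg0 (fun i => ltW (tpos i)))[e e0 te].
  (* Otherwise convexity moves the almost-decrease at [x i] to the fixed
     distance [e], which gives a second minimizer [x0 + e w]. *)
  have fe : f (x0 + e *: w) <= f x0.
    have lim : (fun i => f (x0 + e *: wi i)) @ U --> f (x0 + e *: w).
      apply: ultra_cvg_sum => J _; apply/cvg_enorm/vcvg_blk/vcvg_mulmx.
      by apply: vcvgD; [exact: vcvg_cst|apply: vcvgZ => //; exact: cvg_cst].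
    have lim2 : (fun i => f x0 + e * C2 * harm i) @ U --> f x0.
      rewrite -[X in _ --> X]addr0.
      by apply: cvgD; [exact: cvg_cst|exact: h0].
    apply: (ler_cvg_to lim lim2); apply: filterS te => i ti.
    have et : 0 <= e / t i <= 1.
      by rewrite divr_ge0 ?(ltW e0) ?(ltW (tpos i)) //= ler_pdivrMr ?mul1r ?tpos.
    have := norm12_convex P ybar (D^T *m (x i - x0)) et.
    rewrite scalemxAr -!mulmxDr (addrC x0 (x i - x0)) subrK -scalerA -wiE.
    move=> conv; apply: le_trans conv _.
    have [_ b2] := bounds i.
    have := ler_wpM2l (ltW e0) b2.
    have eE : e = e / t i * t i by rewrite mulfVK ?gt_eqF ?tpos.
    rewrite [X in X * (_ - _)]eE => b2'.
    have : e / t i * (f (x i) - f x0) <= e * C2 * harm i.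
      rewrite -(ler_pM2r (tpos i)).
      by move: b2'; rewrite mulrAC !mulrA.
    move: (e / t i) (e * C2 * _) => a q; lra.
  have xe : x0 + e *: w = x0.
    case: uniq => _; apply; split.
      by rewrite mulmxDr -scalemxAr Phiw scaler0 addr0.
    move=> x' x'y0; apply: le_trans fe _.
    by case: cert_minimizer => _; exact.
  have : e *: w = 0 by apply: (addrI x0); rewrite addr0.
  move/eqP; rewrite scaler_eq0 gt_eqF //= => /eqP w0.
  by move/eqP: w1; rewrite w0 enorm0 eq_sym oner_eq0.
have Ww : Wset P D Phi x0 w.
  apply: (Wset_limit wl Phiw (h0 C2)) => i.
  rewrite -(ler_pM2l (tpos i)) (mulrC _ (C2 * _)).
  apply: le_trans (proj2 (bounds i)); rewrite lerBrDl.
  apply: le_trans (group_dir_le P ybar (D^T *m wi i) (ltW (tpos i))) _.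
  by rewrite scalemxAr -mulmxDr -xE.
have /choice[z zP] i : exists z, group_subgrad P (D^T *m x i) z /\
    D *m z = Phi^T *m ((c * del i)^-1 *: ((S i).1.2 - Phi *m x i)).
  have [d0 _ sol _] := SP i.
  have [|z zs zE] := reg_optimality partP _ sol; first by rewrite mulr_gt0.
  by exists z.
have Ew : Eset P D x0 w.
  have zs i : group_subgrad P (D^T *m (x0 + t i *: wi i)) (z i).
    by rewrite -xE; case: (zP i).
  exact: (nondegenerate_Eset tpos t0 wl zs (fun i => (zP i).2) Ww (nondeg w Ww)).
have w0 := unique_trivial_WE uniq Ww Ew.
by move/eqP: w1; rewrite w0 enorm0 eq_sym oner_eq0.
Qed.

End Recovery.

Theorem corollary4p8 (R : realType) (m n p q : nat)
    (P : {set {set 'I_p}})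
    (partP : finset.partition P [set: 'I_p]%SET) (cardP : #|P| = q)
    (D : 'M[R]_(n, p)) (Phi : 'M[R]_(m, n))
    (y0 : 'cV[R]_m) (x0 : 'cV[R]_n) (v : 'cV[R]_p)
    (minx0 : minimizer P D Phi y0 x0)
    (subv : subdiff (norm12 P) (D^T *m x0) v)
    (Dv : Delta P D Phi x0 (D *m v)) :
  let K := Kset P D x0 v in
  let H := Hset P D x0 v in
  ((forall w, Wset P D Phi x0 w ->
      forall z : tup R K,
        im_sum Phi D H (Dtup D z) ->
        (forall J, val J \in Kdir P D x0 w -> dotv (z J) (blk v (val J)) = 0) ->
        (forall J, val J \notin Kdir P D x0 w ->
           0 <= dotv (z J) (blk v (val J))) ->
        forall J, z J = 0) ->
    (stable_recovery P D Phi y0 x0 <-> unique_minimizer P D Phi y0 x0) /\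
    (unique_minimizer P D Phi y0 x0 <-> strong_minimizer P D Phi y0 x0)) /\
  (Wset P D Phi x0 `&` Eset P D x0 = [set 0] ->
   (forall z : tup R K,
      im_sum Phi D H (Dtup D z) ->
      (forall J, 0 <= dotv (z J) (blk v (val J))) ->
      forall J, z J = 0) ->
   stable_recovery P D Phi y0 x0).
Proof.
move=> K H; have [feas0 _] := minx0.
have sv := subdiff_group_subgrad partP subv.
have [_ [eta _ certv]] := Dv; have {}certv := esym certv.
have strongE := trivial_WE_strong partP feas0 sv certv.
have uniqWE w := @unique_trivial_WE _ _ _ _ _ partP _ _ _ _ _ _ feas0 sv certv w.
have uniq := strong_unique partP feas0 sv certv.
have stab := unique_nondegenerate_stable partP feas0 sv certv.
split=> [nondeg|WE0 nondeg].
  split; split; [exact: (stable_unique partP feas0 sv certv)| | |exact: uniq].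
    by move/stab; exact.
  by move=> u; apply: strongE => w; exact: uniqWE.
apply: stab => [|w _ z imz Kdir0 Kdir_ge0].
  apply/uniq/strongE => w Ww Ew.
  by have : (Wset P D Phi x0 `&` Eset P D x0) w by []; rewrite WE0.
apply: nondeg => // J.
by have [/Kdir0 ->|/Kdir_ge0] := boolP (val J \in Kdir P D x0 w).
Qed.
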